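(* Let $q(t)=(r(t)R(\theta(t))a_1,r(t)R(\theta(t))a_2,r(t)R(\theta(t))a_3)$ be an elliptic relative equilibrium of the charged planar three-body system $m_i\ddot q_i=\sum_{j\ne i}\frac{m_im_j-e_ie_j}{|q_i-q_j|^3}(q_j-q_i)$, $i=1,2,3$, with $\delta_{ij}>0$ for $1\le i<j\le 3$, where $(a_1,a_2,a_3)$ is a non-collinear central configuration of the same charged three-body problem. Then the linearized system of this charged three-body system at $q$ can be transformed to the linearized system of the classical (Newtonian, uncharged) three-body problem at the elliptic equilateral triangle (Lagrangian) solution with the same eccentricity $e\in[0,1)$ and the same $\beta\in[0,9]$, where $\beta=\frac{36(m_1m_2\sin^2\theta_3+m_1m_3\sin^2\theta_2+m_2m_3\sin^2\theta_1)}{(m_1+m_2+m_3)^2}$.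
   Context: Charged planar three-body problem: point particles with masses $m_j>0$ and charges $e_j\in\mathbb{R}$, positions $q_j\in\mathbb{R}^2$, potential $U(q)=\sum_{i<j}\frac{m_im_j-e_ie_j}{|q_i-q_j|}$. Set $\delta_{ij}=1-\frac{e_i}{m_i}\frac{e_j}{m_j}$. $R(\theta)$ is the rotation matrix by angle $\theta$; $z(t)=r(t)(\cos\theta(t),\sin\theta(t))^T$ is a Keplerian orbit with eccentricity $e\in[0,1)$. $\theta_1,\theta_2,\theta_3$ are the inner angles of the triangle formed by the central configuration. *)

(* Defs.v *)
From Stdlib Require Import Reals Lra List.
From Coquelicot Require Import Coquelicot.
Import ListNotations.
Open Scope R_scope.

Inductive body := B1 | B2 | B3.
Definition body_eq_dec (i j : body) : {i = j} + {i <> j}.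
Proof. decide equality. Defined.
Definition bodies : list body := [B1; B2; B3].

Definition vec := (R * R)%type.
Definition v2add (u w : vec) : vec := (fst u + fst w, snd u + snd w).
Definition v2sub (u w : vec) : vec := (fst u - fst w, snd u - snd w).
Definition v2scal (a : R) (u : vec) : vec := (a * fst u, a * snd u).
Definition v2dot (u w : vec) : R := fst u * fst w + snd u * snd w.
Definition v2norm (u : vec) : R := sqrt (v2dot u u).
Definition v2cross (u w : vec) : R := fst u * snd w - snd u * fst w.
Definition rotR (th : R) (u : vec) : vec :=
  (cos th * fst u - sin th * snd u, sin th * fst u + cos th * snd u).

Definition config := body -> vec.

Definition sum_other (i : body) (f : body -> vec) : vec :=
  fold_right (fun j acc => if body_eq_dec j i then acc else v2add (f j) acc)
             (0, 0) bodies.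

Definition force (c : body -> body -> R) (x : config) (i : body) : vec :=
  sum_other i (fun j => v2scal (c i j / (v2norm (v2sub (x j) (x i))) ^ 3)
                               (v2sub (x j) (x i))).

(** Derivative of F_i at x in direction xi (explicit linearization):
    sum_{j<>i} c_ij [ w/|d|^3 - 3 (d.w) d/|d|^5 ],  d = x_j - x_i, w = xi_j - xi_i *)
Definition lin_force (c : body -> body -> R) (x xi : config) (i : body) : vec :=
  sum_other i (fun j =>
    let d := v2sub (x j) (x i) in
    let w := v2sub (xi j) (xi i) in
    v2scal (c i j)
      (v2sub (v2scal (/ (v2norm d) ^ 3) w)
             (v2scal (3 * v2dot d w / (v2norm d) ^ 5) d))).

Definition charged_coef (m ch : body -> R) (i j : body) : R := m i * m j - ch i * ch j.
Definition classical_coef (m : body -> R) (i j : body) : R := m i * m j.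

Definition vderiv (f f' : R -> vec) : Prop :=
  forall t, is_derive (fun s => fst (f s)) t (fst (f' t)) /\
            is_derive (fun s => snd (f s)) t (snd (f' t)).

Definition solves_newton (m : body -> R) (c : body -> body -> R) (x : R -> config) : Prop :=
  exists v a : R -> config,
    (forall i, vderiv (fun t => x t i) (fun t => v t i)) /\
    (forall i, vderiv (fun t => v t i) (fun t => a t i)) /\
    (forall t i, v2scal (m i) (a t i) = force c (x t) i).

Definition solves_linearized (m : body -> R) (c : body -> body -> R)
    (q : R -> config) (xi v : R -> config) : Prop :=
  exists a : R -> config,
    (forall i, vderiv (fun t => xi t i) (fun t => v t i)) /\
    (forall i, vderiv (fun t => v t i) (fun t => a t i)) /\
    (forall t i, v2scal (m i) (a t i) = lin_force c (q t) (xi t) i).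

Definition center_of_mass (m : body -> R) (a : config) : vec :=
  v2scal (/ (m B1 + m B2 + m B3))
    (v2add (v2scal (m B1) (a B1)) (v2add (v2scal (m B2) (a B2)) (v2scal (m B3) (a B3)))).
Definition central_configuration (m : body -> R) (c : body -> body -> R) (a : config) : Prop :=
  exists lambda : R, forall i,
    force c a i = v2scal (- lambda * m i) (v2sub (a i) (center_of_mass m a)).

Definition non_collinear (a : config) : Prop :=
  v2cross (v2sub (a B2) (a B1)) (v2sub (a B3) (a B1)) <> 0.

Definition equilateral (b : config) : Prop :=
  non_collinear b /\
  v2norm (v2sub (b B1) (b B2)) = v2norm (v2sub (b B2) (b B3)) /\
  v2norm (v2sub (b B2) (b B3)) = v2norm (v2sub (b B3) (b B1)).

Definition inner_angle (a : config) (k : body) : R :=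
  let '(u, w) := match k with
                 | B1 => (v2sub (a B2) (a B1), v2sub (a B3) (a B1))
                 | B2 => (v2sub (a B1) (a B2), v2sub (a B3) (a B2))
                 | B3 => (v2sub (a B1) (a B3), v2sub (a B2) (a B3))
                 end in
  acos (v2dot u w / (v2norm u * v2norm w)).

Definition beta (m : body -> R) (a : config) : R :=
  36 * (m B1 * m B2 * (sin (inner_angle a B3)) ^ 2
        + m B1 * m B3 * (sin (inner_angle a B2)) ^ 2
        + m B2 * m B3 * (sin (inner_angle a B1)) ^ 2)
     / (m B1 + m B2 + m B3) ^ 2.

Definition kz (r th : R -> R) (t : R) : vec := (r t * cos (th t), r t * sin (th t)).

(** Eccentricity of the Kepler orbit through position z with velocity v
    (norm of the Laplace-Runge-Lenz vector (v x h)/mu - z/|z|). *)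
Definition eccentricity (mu : R) (z v : vec) : R :=
  let h := v2cross z v in
  v2norm (v2sub (v2scal (/ mu) (snd v * h, - fst v * h)) (v2scal (/ v2norm z) z)).

Definition keplerian_orbit (r th : R -> R) (e : R) : Prop :=
  (forall t, 0 < r t) /\
  exists (mu : R) (v a : R -> vec), 0 < mu /\
    vderiv (kz r th) v /\ vderiv v a /\
    (forall t, a t = v2scal (- mu / (v2norm (kz r th t)) ^ 3) (kz r th t)) /\
    eccentricity mu (kz r th 0) (v 0) = e.

Definition homographic (r th : R -> R) (a : config) (t : R) : config :=
  fun i => v2scal (r t) (rotR (th t) (a i)).

Definition min_period (q : R -> config) (T : R) : Prop :=
  0 < T /\ (forall t i, q (t + T) i = q t i) /\
  (forall s, 0 < s < T -> exists t i, q (t + s) i <> q t i).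

(** Phase-space states (position variation, velocity variation) of each body. *)
Definition state := body -> (vec * vec).
Definition st_lin (a : R) (x y : state) : state :=
  fun i => ((v2add (v2scal a (fst (x i))) (fst (y i))),
            (v2add (v2scal a (snd (x i))) (snd (y i)))).
Definition mk_state (xi v : config) : state := fun i => (xi i, v i).

Definition admissible_transform (P : R -> state -> state) (T : R) : Prop :=
  (forall t a x y i, P t (st_lin a x y) i = st_lin a (P t x) (P t y) i) /\
  (forall t x y, (forall i, P t x i = P t y i) -> forall i, x i = y i) /\
  (forall t y, exists x, forall i, P t x i = y i) /\
  (forall x i t, continuous (fun s => fst (fst (P s x i))) t /\
                 continuous (fun s => snd (fst (P s x i))) t /\
                 continuous (fun s => fst (snd (P s x i))) t /\
                 continuous (fun s => snd (snd (P s x i))) t) /\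
  (forall t x i, P (t + T) x i = P t x i).

(* Main.v *)
Require Import Defs.
From Stdlib Require Import Reals Lra ZArith Lia FunctionalExtensionality.
From Coquelicot Require Import Coquelicot.
(* Repeated because [Reals] shadows the constructors [B1], [B2]. *)
Import Defs.
Open Scope R_scope.

(** Identify the plane with the complex numbers, so that q_i = z a_i with z a
    Kepler orbit.  Non-collinearity forces c_ij / |a_i - a_j|^3 = mu m_i m_j / M,
    so the charges disappear from the linearized equations, and only the
    directions of the sides remain.  With l_i the side opposite to a_i,
    n_i = conj(l_i) / m_i and xi_i = x + y a_i + w n_i, the linearized system
    decouples into
      x'' = 0,
      y'' = (mu/|z|^3) (y/2 + (3/2) Z conj(y)),
      w'' = (mu/|z|^3) (w/2 - (3/2) Z u conj(w)),
    where Z = z / conj(z) and u is a complex number with |u|^2 = 1 - beta/9.  Hence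
    beta <= 9, and a system with the same beta differs only in the phase of u, which
    is absorbed by rotating w.  Two Kepler orbits of the same eccentricity agree up
    to a similarity (possibly a reflection) and an affine change of time: match
    them at their pericenters and use uniqueness for the Kepler equation.  The
    resulting transformation of phase space does not depend on time. *)

(** * The linearized force in coordinates adapted to the configuration *)

Local Open Scope C_scope.

(** The cyclic orientation makes the three sides add up to zero and keeps the formulas below
    invariant under cyclic relabelling of the bodies. *)
Definition side (a : body -> C) (k : body) : C :=
  match k with B1 => a B3 - a B2 | B2 => a B1 - a B3 | B3 => a B2 - a B1 end.
(** For l nonzero this is (l/|l|)^2, the square of the unit vector along l; it takes the same value
    at l and -l. *)
Definition dirsq (l : C) : C := l / Cconj l.
Definition total (m : body -> R) : R := (m B1 + m B2 + m B3)%R.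
(* The number u of the header. *)
Definition shear (m : body -> R) (a : body -> C) : C :=
  - (m B1 * dirsq (side a B2) * dirsq (side a B3)
     + m B2 * dirsq (side a B1) * dirsq (side a B3)
     + m B3 * dirsq (side a B1) * dirsq (side a B2)) / total m.
(* Orthogonal, for the Hermitian product weighted by the masses, to (1, 1, 1) and to [a]. *)
Definition normal_vec (m : body -> R) (a : body -> C) (k : body) : C :=
  Cconj (side a k) / m k.
(** The values of [X] at [B1], [B2], [B3] are the coordinates x, y, w of the header, not quantities
    attached to single bodies. *)
Definition assemble (m : body -> R) (a X : body -> C) (i : body) : C :=
  X B1 + X B2 * a i + X B3 * normal_vec m a i.

(* [vec] and [C] are convertible, but [ring] and [field] select their structure from
   the type of the equation. *)
Ltac C_eq := match goal with |- @eq _ ?x ?y => change (@eq C x y) end.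

Lemma v2norm_Cmod (x : C) : v2norm x = Cmod x.
Proof. unfold v2norm, v2dot, Cmod. f_equal. ring. Qed.
Lemma v2scal_C (s : R) (x : C) : v2scal s x = s * x.
Proof. apply injective_projections; simpl; ring. Qed.
Lemma v2sub_C (x y : C) : v2sub x y = x - y.
Proof. reflexivity. Qed.
Lemma sum_other_C (i : body) (f : body -> C) :
  sum_other i f = match i with B1 => f B2 + f B3 | B2 => f B1 + f B3 | B3 => f B1 + f B2 end.
Proof. destruct i; apply injective_projections; simpl; ring. Qed.

Lemma Cconj_neq_0 (x : C) : x <> 0 -> Cconj x <> 0.
Proof. intros H E. apply H. rewrite <- (Cconj_conj x), E. apply injective_projections; simpl; ring. Qed.
Lemma RtoC_neq_0 (x : R) : x <> 0%R -> RtoC x <> 0.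
Proof. intros H E. apply H. now apply RtoC_inj. Qed.
Lemma Cconj_RtoC (x : R) : Cconj x = x.
Proof. apply injective_projections; simpl; ring. Qed.

Lemma dirsq_v2norm (d : C) : d <> 0 ->
  dirsq d = (/ (v2norm d * v2norm d))%R * (d * d).
Proof.
intros Hd. rewrite v2norm_Cmod.
assert (Hc := Cconj_neq_0 _ Hd). assert (Hm := proj1 (Cmod_gt_0 _) Hd).
rewrite RtoC_inv by nra.
replace (Cmod d * Cmod d)%R with (Cmod d ^ 2)%R by ring.
rewrite Cmod2_conj. unfold dirsq. field. split; auto.
Qed.

(** In complex notation d.w = (conj(d) w + d conj(w))/2. Hence 3 (d.w) d / |d|^2 = (3/2) w + (3/2)
    (d/conj(d)) conj(w), and subtracting this from w leaves the right-hand side. *)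
Lemma pair_linearization (k : R) (d w : C) : d <> 0 ->
  v2scal k (v2sub (v2scal (/ (v2norm d) ^ 3) w)
             (v2scal (3 * v2dot d w / (v2norm d) ^ 5) d))
  = RtoC (k / (v2norm d) ^ 3) * (- (1/2) * w - 3/2 * dirsq d * Cconj w).
Proof.
intros Hd.
assert (H0 : (0 < v2norm d)%R) by (rewrite v2norm_Cmod; now apply Cmod_gt_0).
assert (H2 : (v2norm d * v2norm d = v2dot d d)%R).
{ unfold v2norm at 1 2. apply sqrt_sqrt. unfold v2dot. nra. }
replace (1/2) with (RtoC (1/2)) by (rewrite RtoC_div by lra; reflexivity).
replace (3/2) with (RtoC (3/2)) by (rewrite RtoC_div by lra; reflexivity).
rewrite (dirsq_v2norm d Hd).
set (s := v2norm d) in *. clearbody s. destruct d as [d1 d2], w as [w1 w2].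
unfold v2dot in *; simpl in *.
(* The only relation between the norm s and the components of d; it eliminates d1^2 in both
   components below. *)
assert (Hs : (d1*d1 = s*s-d2*d2)%R) by lra.
assert (s <> 0%R) by lra.
apply injective_projections; simpl.
- field_simplify; auto.
  replace (d1^2)%R with (s*s-d2*d2)%R by lra.
  field; auto.
- field_simplify; auto.
  replace (d1^2)%R with (s*s-d2*d2)%R by lra.
  field; auto.
Qed.

Definition normal_rhs (k : R) (Z u : C) (X : body -> C) (i : body) : C :=
  match i with
  | B1 => 0
  | B2 => RtoC k * (1/2 * X B2 + 3/2 * Z * Cconj (X B2))
  | B3 => RtoC k * (1/2 * X B3 - 3/2 * Z * u * Cconj (X B3))
  end.

Definition lin_accel (m : body -> R) (c : body -> body -> R) (q X : body -> C) (i : body) : C :=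
  v2scal (/ m i) (lin_force c q X i).

(** The equation of one body, with the conjugates of a_i, y, w replaced by independent variables
    p_i, y', w'. The terms in a collapse because sum m_j (a_j - a_1) = -M a_1 and U_k times a
    conjugate side is the side itself; the terms in n use sum m_j n_j = 0, and the remaining mixed
    products form the shear. *)
Lemma body_identity (m1 m2 m3 a1 a2 a3 p1 p2 p3 Z y y' w w' K : C) :
  m1 <> 0 -> m2 <> 0 -> m3 <> 0 -> m1 + m2 + m3 <> 0 ->
  p3 - p2 <> 0 -> p1 - p3 <> 0 -> p2 - p1 <> 0 ->
  m1 * a1 + m2 * a2 + m3 * a3 = 0 ->
  let U1 := (a3 - a2) / (p3 - p2) in
  let U2 := (a1 - a3) / (p1 - p3) in
  let U3 := (a2 - a1) / (p2 - p1) in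
  let n1 := (p3 - p2) / m1 in let n2 := (p1 - p3) / m2 in let n3 := (p2 - p1) / m3 in
  let n1' := (a3 - a2) / m1 in let n2' := (a1 - a3) / m2 in let n3' := (a2 - a1) / m3 in
  / m1 * (K * (m1 * m2 / (m1 + m2 + m3))
            * (- (1/2) * (y * (a2 - a1) + w * (n2 - n1))
               - 3/2 * Z * U3 * (y' * (p2 - p1) + w' * (n2' - n1')))
          + K * (m1 * m3 / (m1 + m2 + m3))
            * (- (1/2) * (y * (a3 - a1) + w * (n3 - n1))
               - 3/2 * Z * U2 * (y' * (p3 - p1) + w' * (n3' - n1'))))
  = K * (1/2 * y + 3/2 * Z * y') * a1
    + K * (1/2 * w - 3/2 * Z * (- (m1 * U2 * U3 + m2 * U1 * U3 + m3 * U1 * U2) / (m1 + m2 + m3)) * w') * n1.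
Proof.
intros M1 M2 M3 M P1 P2 P3 H. cbv zeta.
(* Once a3 is eliminated through the center of mass, a rational identity in free variables
   remains. *)
assert (E : a3 = - (m1 * a1 + m2 * a2) / m3).
{ replace (m1 * a1 + m2 * a2) with (m1 * a1 + m2 * a2 + m3 * a3 - m3 * a3) by ring.
  rewrite H. field. auto. }
subst a3.
field. repeat split; auto.
Qed.

(** The charges disappear here. Since q_j - q_i = z (a_j - a_i), the hypothesis [Hc] turns each
    coefficient into (mu/|z|^3) m_i m_j / M, and the squared direction factors as
    [dirsq z * dirsq (a j - a i)]. *)
Lemma lin_accel_assemble (m : body -> R) c (mu : R) (a X : body -> C) (z : C) (i : body)
  (Hm : forall i, (0 < m i)%R) (Hz : z <> 0)
  (Hs : forall k, side a k <> 0)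
  (Hc : forall i j, i <> j -> (c i j / v2norm (v2sub (a j) (a i)) ^ 3 = mu * m i * m j / total m)%R)
  (Hcm : m B1 * a B1 + m B2 * a B2 + m B3 * a B3 = 0) :
  lin_accel m c (fun j => z * a j) (assemble m a X) i
  = assemble m a (normal_rhs (mu / v2norm z ^ 3) (dirsq z) (shear m a) X) i.
Proof.
assert (Hpair : forall i j w, i <> j -> a j - a i <> 0 ->
  v2scal (c i j) (v2sub (v2scal (/ (v2norm (z * a j - z * a i)) ^ 3) w)
     (v2scal (3 * v2dot (z * a j - z * a i) w / (v2norm (z * a j - z * a i)) ^ 5) (z * a j - z * a i)))
  = RtoC (mu / v2norm z ^ 3) * (m i * m j / total m) * (- (1/2) * w - 3/2 * dirsq z * dirsq (a j - a i) * Cconj w)).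
{ intros i' j w Hij Hl.
  replace (z * a j - z * a i') with (z * (a j - a i')) by ring.
  rewrite pair_linearization by now apply Cmult_neq_0.
  assert (v2norm z <> 0%R) by (rewrite v2norm_Cmod; now apply Cmod_gt_0 in Hz; lra).
  assert (v2norm (a j - a i') <> 0%R) by (rewrite v2norm_Cmod; now apply Cmod_gt_0 in Hl; lra).
  assert (total m <> 0%R) by (unfold total; generalize (Hm B1) (Hm B2) (Hm B3); lra).
  assert (E : (c i' j / v2norm (z * (a j - a i'))%C ^ 3 = mu / v2norm z ^ 3 * (m i' * m j / total m))%R).
  { transitivity (/ v2norm z ^ 3 * (c i' j / v2norm (v2sub (a j) (a i')) ^ 3))%R.
    - change (v2sub (a j) (a i')) with (a j - a i'). rewrite !v2norm_Cmod, Cmod_mult in *. field. auto.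
    - rewrite (Hc _ _ Hij). field. auto. }
  rewrite E, RtoC_mult, (RtoC_div (m i' * m j)), RtoC_mult by auto.
  replace (dirsq (z * (a j - a i'))) with (dirsq z * dirsq (a j - a i')).
  - C_eq. ring.
  - unfold dirsq. rewrite Cmult_conj. field. split; apply Cconj_neq_0; auto. }
unfold lin_accel. rewrite v2scal_C.
assert (M1 : RtoC (m B1) <> 0) by (apply RtoC_neq_0; specialize (Hm B1); lra).
assert (M2 : RtoC (m B2) <> 0) by (apply RtoC_neq_0; specialize (Hm B2); lra).
assert (M3 : RtoC (m B3) <> 0) by (apply RtoC_neq_0; specialize (Hm B3); lra).
assert (M : RtoC (total m) <> 0) by (apply RtoC_neq_0; unfold total; generalize (Hm B1) (Hm B2) (Hm B3); lra).
assert (MS : m B1 + m B2 + m B3 <> 0) by (unfold total in M; now rewrite !RtoC_plus in M).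
assert (S1 := Hs B1). assert (S2 := Hs B2). assert (S3 := Hs B3). simpl in S1, S2, S3.
assert (K1 := Cconj_neq_0 _ S1). assert (K2 := Cconj_neq_0 _ S2). assert (K3 := Cconj_neq_0 _ S3).
rewrite Cminus_conj in K1, K2, K3.
assert (Sopp : forall x y : C, x - y <> 0 -> y - x <> 0).
{ intros x y Hxy E. apply Hxy. replace (x - y) with (- (y - x)) by ring. rewrite E. ring. }
rewrite RtoC_inv by (specialize (Hm i); lra).
assert (HnC : forall k, Cconj (normal_vec m a k) = side a k / m k).
{ intros k. unfold normal_vec. rewrite Cdiv_conj, Cconj_conj, Cconj_RtoC; auto.
  apply RtoC_neq_0. specialize (Hm k). lra. }
assert (HT : RtoC (total m) = m B1 + m B2 + m B3) by (unfold total; now rewrite !RtoC_plus).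
set (Z := dirsq z) in *. set (K := RtoC (mu / v2norm z ^ 3)) in *.
(* [body_identity] treats the first body; the other two follow by cyclic relabelling. *)
assert (Id : forall i j k, (i = B1 /\ j = B2 /\ k = B3) \/ (i = B2 /\ j = B3 /\ k = B1) \/ (i = B3 /\ j = B1 /\ k = B2) ->
  / m i * (K * (m i * m j / total m) * (- (1/2) * (assemble m a X j - assemble m a X i)
              - 3/2 * Z * dirsq (a j - a i) * Cconj (assemble m a X j - assemble m a X i))
          + K * (m i * m k / total m) * (- (1/2) * (assemble m a X k - assemble m a X i)
              - 3/2 * Z * dirsq (a k - a i) * Cconj (assemble m a X k - assemble m a X i)))
  = assemble m a (normal_rhs (mu / v2norm z ^ 3) Z (shear m a) X) i).
{ intros i' j k Hijk. unfold shear, assemble, normal_rhs. fold K.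
  rewrite ?Cminus_conj, ?Cplus_conj, ?Cmult_conj, !HnC, HT. unfold normal_vec.
  destruct Hijk as [[-> [-> ->]]|[[-> [-> ->]]|[-> [-> ->]]]].
  - assert (J := body_identity (m B1) (m B2) (m B3) (a B1) (a B2) (a B3)
      (Cconj (a B1)) (Cconj (a B2)) (Cconj (a B3)) Z (X B2) (Cconj (X B2)) (X B3) (Cconj (X B3)) K).
    cbv zeta in J. unfold side, dirsq. rewrite !Cminus_conj.
    etransitivity; [|etransitivity; [apply J|]]; auto.
    + field. repeat split; auto.
    + field. repeat split; auto.
  - assert (J := body_identity (m B2) (m B3) (m B1) (a B2) (a B3) (a B1)
      (Cconj (a B2)) (Cconj (a B3)) (Cconj (a B1)) Z (X B2) (Cconj (X B2)) (X B3) (Cconj (X B3)) K).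
    assert (MS' : m B2 + m B3 + m B1 <> 0) by (replace (m B2 + m B3 + m B1) with (m B1 + m B2 + m B3) by ring; auto).
    assert (Hcm' : m B2 * a B2 + m B3 * a B3 + m B1 * a B1 = 0) by (rewrite <- Hcm; ring).
    cbv zeta in J. unfold side, dirsq. rewrite !Cminus_conj.
    etransitivity; [|etransitivity; [apply J|]]; auto.
    + field. repeat split; auto.
    + field. repeat split; auto.
  - assert (J := body_identity (m B3) (m B1) (m B2) (a B3) (a B1) (a B2)
      (Cconj (a B3)) (Cconj (a B1)) (Cconj (a B2)) Z (X B2) (Cconj (X B2)) (X B3) (Cconj (X B3)) K).
    assert (MS' : m B3 + m B1 + m B2 <> 0) by (replace (m B3 + m B1 + m B2) with (m B1 + m B2 + m B3) by ring; auto).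
    assert (Hcm' : m B3 * a B3 + m B1 * a B1 + m B2 * a B2 = 0) by (rewrite <- Hcm; ring).
    cbv zeta in J. unfold side, dirsq. rewrite !Cminus_conj.
    etransitivity; [|etransitivity; [apply J|]]; auto.
    + field. repeat split; auto.
    + field. repeat split; auto. }
assert (E := sum_other_C i). unfold lin_force.
destruct i; rewrite E; rewrite !v2sub_C, !Hpair by (discriminate || auto);
  fold K Z.
- etransitivity; [|apply (Id B1 B2 B3); tauto]. reflexivity.
(* For [B2] the force lists the bodies as [B1], [B3], whereas the cyclic order is [B3], [B1]; the
   summands are exchanged. *)
- etransitivity; [|apply (Id B2 B3 B1); tauto]. change v2sub with Cminus. C_eq; ring.
- etransitivity; [|apply (Id B3 B1 B2); tauto]. reflexivity.
Qed.

(** * The inverse change of coordinates *)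

Definition inertia (m : body -> R) (a : body -> C) : C :=
  m B1 * Cconj (a B1) * a B1 + m B2 * Cconj (a B2) * a B2 + m B3 * Cconj (a B3) * a B3.

(** Orthogonal projections, for the Hermitian product weighted by the masses, onto (1, 1, 1), [a]
    and [normal_vec m a]. The denominators are the squared norms of these vectors when the center of
    mass is at the origin; in the third numerator m_k conj(n_k) is the side l_k. *)
Definition coords (m : body -> R) (a X : body -> C) (k : body) : C :=
  match k with
  | B1 => (m B1 * X B1 + m B2 * X B2 + m B3 * X B3) / total m
  | B2 => (m B1 * Cconj (a B1) * X B1 + m B2 * Cconj (a B2) * X B2 + m B3 * Cconj (a B3) * X B3)
          / inertia m a
  | B3 => (side a B1 * X B1 + side a B2 * X B2 + side a B3 * X B3)
          / (inertia m a * total m / (m B1 * m B2 * m B3))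
  end.

(** The first component of the expansion of x in the orthogonal basis, with p_i standing for the
    conjugate of a_i, so that it becomes a rational identity once a3 and p3 are eliminated. *)
Lemma coords_identity (m1 m2 m3 a1 a2 a3 p1 p2 p3 x1 x2 x3 : C) :
  m1 <> 0 -> m2 <> 0 -> m3 <> 0 -> m1 + m2 + m3 <> 0 ->
  m1 * a1 + m2 * a2 + m3 * a3 = 0 ->
  m1 * p1 + m2 * p2 + m3 * p3 = 0 ->
  let I := m1 * p1 * a1 + m2 * p2 * a2 + m3 * p3 * a3 in
  I <> 0 ->
  (m1 * x1 + m2 * x2 + m3 * x3) / (m1 + m2 + m3)
  + (m1 * p1 * x1 + m2 * p2 * x2 + m3 * p3 * x3) / I * a1
  + ((a3 - a2) * x1 + (a1 - a3) * x2 + (a2 - a1) * x3)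
    / (I * (m1 + m2 + m3) / (m1 * m2 * m3)) * ((p3 - p2) / m1) = x1.
Proof.
intros M1 M2 M3 M H H' I HI. subst I.
assert (E : a3 = - (m1 * a1 + m2 * a2) / m3).
{ replace (m1 * a1 + m2 * a2) with (m1 * a1 + m2 * a2 + m3 * a3 - m3 * a3) by ring.
  rewrite H. field. auto. }
assert (E' : p3 = - (m1 * p1 + m2 * p2) / m3).
{ replace (m1 * p1 + m2 * p2) with (m1 * p1 + m2 * p2 + m3 * p3 - m3 * p3) by ring.
  rewrite H'. field. auto. }
subst a3 p3.

field. repeat split; auto.
(* The denominator left by [field] is m3 times the inertia, written without a3 and p3. *)
intros E. apply HI.
transitivity (((m1 * p1 * a1 + m2 * p2 * a2) * m3 +
  - (m1 * p1 + m2 * p2) * - (m1 * a1 + m2 * a2)) / m3).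
- field. auto.
- rewrite E. field. auto.
Qed.

Lemma inertia_neq_0 (m : body -> R) (a : body -> C) :
  (forall i, (0 < m i)%R) -> side a B3 <> 0 -> inertia m a <> 0.
Proof.
intros Hm Hs E. apply Hs. unfold side.
assert (P : forall x : C, x * Cconj x = RtoC (fst x * fst x + snd x * snd x)).
{ intros x. apply injective_projections; simpl; ring. }
unfold inertia in E. rewrite <- !Cmult_assoc, !(Cmult_comm (Cconj _)), !P in E.
rewrite <- !RtoC_mult, <- !RtoC_plus in E. apply RtoC_inj in E.
destruct (a B1) as [x1 y1], (a B2) as [x2 y2], (a B3) as [x3 y3]. simpl in E.
assert (Q : forall i x y, (0 <= m i * (x*x+y*y))%R).
{ intros i x y. apply Rmult_le_pos; [specialize (Hm i); lra | nra]. }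
assert (Z : forall i x y, (m i * (x*x+y*y) = 0)%R -> x = 0%R /\ y = 0%R).
{ intros i x y H. apply Rmult_integral in H. destruct H; [specialize (Hm i); lra|]. split; nra. }
destruct (Z B1 x1 y1) as [-> ->]; [generalize (Q B1 x1 y1) (Q B2 x2 y2) (Q B3 x3 y3); lra|].
destruct (Z B2 x2 y2) as [-> ->]; [generalize (Q B2 x2 y2) (Q B3 x3 y3); lra|].
apply injective_projections; simpl; ring.
Qed.

Lemma Cconj_cm (m : body -> R) (a : body -> C) :
  m B1 * a B1 + m B2 * a B2 + m B3 * a B3 = 0 ->
  m B1 * Cconj (a B1) + m B2 * Cconj (a B2) + m B3 * Cconj (a B3) = 0.
Proof.
intros H. rewrite <- (Cconj_RtoC (m B1)), <- (Cconj_RtoC (m B2)), <- (Cconj_RtoC (m B3)).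
rewrite <- !Cmult_conj, <- !Cplus_conj, H. apply Cconj_RtoC.
Qed.

Lemma assemble_coords (m : body -> R) (a X : body -> C) (i : body) :
  (forall i, (0 < m i)%R) -> side a B3 <> 0 ->
  m B1 * a B1 + m B2 * a B2 + m B3 * a B3 = 0 ->
  assemble m a (coords m a X) i = X i.
Proof.
intros Hm Hs Hcm.
assert (HI := inertia_neq_0 _ _ Hm Hs). assert (Hcm' := Cconj_cm _ _ Hcm).
assert (M1 : RtoC (m B1) <> 0) by (apply RtoC_neq_0; specialize (Hm B1); lra).
assert (M2 : RtoC (m B2) <> 0) by (apply RtoC_neq_0; specialize (Hm B2); lra).
assert (M3 : RtoC (m B3) <> 0) by (apply RtoC_neq_0; specialize (Hm B3); lra).
assert (HT : RtoC (total m) = m B1 + m B2 + m B3) by (unfold total; now rewrite !RtoC_plus).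
assert (M : RtoC (total m) <> 0) by (apply RtoC_neq_0; unfold total; generalize (Hm B1) (Hm B2) (Hm B3); lra).
(* [coords_identity] concerns the first body; cyclic rotation of every sum brings the second and
   third bodies into that position. *)
assert (Rot : forall x y z : C, x + y + z = y + z + x) by (intros; ring).
unfold assemble, coords, normal_vec. unfold inertia in *. rewrite HT in *.
destruct i; unfold side; rewrite !Cminus_conj.
- apply coords_identity; auto.
- rewrite (Rot (m B1)), (Rot (m B1 * X B1)) in *.
  rewrite (Rot (m B1 * Cconj (a B1) * a B1)), (Rot (m B1 * Cconj (a B1) * X B1)), (Rot ((a B3 - a B2) * X B1)) in *.
  replace (m B1 * m B2 * m B3) with (m B2 * m B3 * m B1) by ring.
  rewrite (Rot (m B1 * a B1)) in Hcm. rewrite (Rot (m B1 * Cconj (a B1))) in Hcm'.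
  apply coords_identity; auto.
- rewrite !(Rot (m B1)), !(Rot (m B1 * X B1)) in *.
  rewrite !(Rot (m B1 * Cconj (a B1) * a B1)), !(Rot (m B1 * Cconj (a B1) * X B1)), !(Rot ((a B3 - a B2) * X B1)) in *.
  rewrite !(Rot (m B2)), !(Rot (m B2 * X B2)) in *.
  rewrite !(Rot (m B2 * Cconj (a B2) * a B2)), !(Rot (m B2 * Cconj (a B2) * X B2)), !(Rot ((a B1 - a B3) * X B2)) in *.
  replace (m B1 * m B2 * m B3) with (m B3 * m B1 * m B2) by ring.
  rewrite !(Rot (m B1 * a B1)), (Rot (m B2 * a B2)) in Hcm.
  rewrite !(Rot (m B1 * Cconj (a B1))), (Rot (m B2 * Cconj (a B2))) in Hcm'.
  apply coords_identity; auto.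
Qed.

Lemma coords_assemble (m : body -> R) (a X : body -> C) (k : body) :
  (forall i, (0 < m i)%R) -> side a B3 <> 0 ->
  m B1 * a B1 + m B2 * a B2 + m B3 * a B3 = 0 ->
  coords m a (assemble m a X) k = X k.
Proof.
intros Hm Hs Hcm.
assert (HI := inertia_neq_0 _ _ Hm Hs). assert (Hcm' := Cconj_cm _ _ Hcm).
assert (M1 : RtoC (m B1) <> 0) by (apply RtoC_neq_0; specialize (Hm B1); lra).
assert (M2 : RtoC (m B2) <> 0) by (apply RtoC_neq_0; specialize (Hm B2); lra).
assert (M3 : RtoC (m B3) <> 0) by (apply RtoC_neq_0; specialize (Hm B3); lra).
assert (HT : RtoC (total m) = m B1 + m B2 + m B3) by (unfold total; now rewrite !RtoC_plus).
assert (M : RtoC (total m) <> 0) by (apply RtoC_neq_0; unfold total; generalize (Hm B1) (Hm B2) (Hm B3); lra).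
set (I := inertia m a) in *.
assert (E : I = inertia m a) by reflexivity. unfold inertia in E.
unfold assemble, coords, normal_vec. fold I. rewrite HT in *.
set (m1 := RtoC (m B1)) in *. set (m2 := RtoC (m B2)) in *. set (m3 := RtoC (m B3)) in *.
unfold side; rewrite !Cminus_conj.
set (p1 := Cconj (a B1)) in *. set (p2 := Cconj (a B2)) in *. set (p3 := Cconj (a B3)) in *.
set (a1 := a B1) in *. set (a2 := a B2) in *. set (a3 := a B3) in *.
clearbody m1 m2 m3 p1 p2 p3 a1 a2 a3 I.
destruct k.
- transitivity (X B1 + X B2 * (m1 * a1 + m2 * a2 + m3 * a3) / (m1 + m2 + m3)); [field; auto|].
  rewrite Hcm. field. auto.
- transitivity ((X B1 * (m1 * p1 + m2 * p2 + m3 * p3) + X B2 * (m1 * p1 * a1 + m2 * p2 * a2 + m3 * p3 * a3)) / I);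
   [field; auto|].
  rewrite Hcm', <- E. field. auto.
(* Lagrange's identity sum m_i m_j |a_i - a_j|^2 = M I - |sum m_i a_i|^2, divided by the product of
   the masses. *)
- assert (HW : ((a3 - a2) * (p3 - p2) / m1 + (a1 - a3) * (p1 - p3) / m2 + (a2 - a1) * (p2 - p1) / m3)
     = I * (m1 + m2 + m3) / (m1 * m2 * m3)).
  { rewrite E. transitivity (((m1 * p1 * a1 + m2 * p2 * a2 + m3 * p3 * a3) * (m1 + m2 + m3)
      - (m1 * a1 + m2 * a2 + m3 * a3) * (m1 * p1 + m2 * p2 + m3 * p3)) / (m1 * m2 * m3)).
    - field; auto.
    - rewrite Hcm, Hcm'. field. auto. }
  transitivity (X B3 * ((a3 - a2) * (p3 - p2) / m1 + (a1 - a3) * (p1 - p3) / m2 + (a2 - a1) * (p2 - p1) / m3)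
    / (I * (m1 + m2 + m3) / (m1 * m2 * m3))).
  + field. auto.
  + rewrite HW. field. auto.
Qed.

Local Close Scope C_scope.

(** * The parameter beta and the shape of the central configuration *)

Lemma v2norm_sq (u : vec) : v2norm u * v2norm u = v2dot u u.
Proof. unfold v2norm. apply sqrt_sqrt. unfold v2dot. nra. Qed.

Lemma v2norm_pos (u : vec) : u <> (0, 0) -> 0 < v2norm u.
Proof. intros H. change u with (u : C). rewrite v2norm_Cmod. now apply Cmod_gt_0. Qed.

(** Lagrange's identity (u.w)^2 + (u x w)^2 = |u|^2 |w|^2 gives 1 - cos^2, and also shows that the
    argument of [acos] lies in [-1, 1]. *)
Lemma sin_angle_sq (u w : vec) : u <> (0, 0) -> w <> (0, 0) ->
  sin (acos (v2dot u w / (v2norm u * v2norm w))) ^ 2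
  = v2cross u w ^ 2 / (v2dot u u * v2dot w w).
Proof.
intros Hu Hw. apply v2norm_pos in Hu. apply v2norm_pos in Hw.
rewrite <- !v2norm_sq.
assert (L : v2dot u w ^ 2 + v2cross u w ^ 2 = (v2norm u * v2norm u) * (v2norm w * v2norm w)).
{ rewrite !v2norm_sq. unfold v2dot, v2cross. ring. }
set (s := v2norm u) in *. set (t := v2norm w) in *.
assert (0 < s * t) by nra.
set (x := v2dot u w / (s * t)).
assert (Hx : x * x = 1 - v2cross u w ^ 2 / (s * s * (t * t))).
{ unfold x. replace (v2cross u w ^ 2) with (s * s * (t * t) - v2dot u w ^ 2) by lra. field. lra. }
assert (0 <= v2cross u w ^ 2 / (s * s * (t * t))).
{ apply Rmult_le_pos; [nra|]. apply Rlt_le, Rinv_0_lt_compat. nra. }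
assert (-1 <= x <= 1) by nra.
assert (Q := sin2_cos2 (acos x)). rewrite cos_acos in Q by auto. unfold Rsqr in Q. simpl. lra.
Qed.

Local Open Scope C_scope.

Lemma v2dot_self_C (u : C) : RtoC (v2dot u u) = u * Cconj u.
Proof. apply injective_projections; unfold v2dot; simpl; ring. Qed.

(** The imaginary part of u conj(w) is minus the cross product, so the difference on the right is
    -2i times it. *)
Lemma v2cross_sq_C (u w : C) : -4 * RtoC (v2cross u w ^ 2) = (u * Cconj w - Cconj u * w) * (u * Cconj w - Cconj u * w).
Proof. destruct u as [u1 u2], w as [w1 w2]. apply injective_projections; unfold v2cross; simpl; ring. Qed.

(** This is u conj(u), with k_i for the conjugate of l_i. Put d_i = l_i/k_i. In the expansion, m_i
    m_j multiplies d_i/d_j + d_j/d_i, and (l_i k_j - k_i l_j)^2 / (l_i k_i l_j k_j) is this number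
    minus 2; the 2s complete the square of the total mass. *)
Lemma shear_norm_identity (m1 m2 m3 l1 l2 l3 k1 k2 k3 : C) :
  m1 + m2 + m3 <> 0 -> l1 <> 0 -> l2 <> 0 -> l3 <> 0 -> k1 <> 0 -> k2 <> 0 -> k3 <> 0 ->
  (- (m1 * (l2/k2) * (l3/k3) + m2 * (l1/k1) * (l3/k3) + m3 * (l1/k1) * (l2/k2)) / (m1 + m2 + m3))
  * (- (m1 * (k2/l2) * (k3/l3) + m2 * (k1/l1) * (k3/l3) + m3 * (k1/l1) * (k2/l2)) / (m1 + m2 + m3))
  = 1 + (m1 * m2 * (((l1 * k2 - k1 * l2) * (l1 * k2 - k1 * l2)) / (l1 * k1 * (l2 * k2)))
       + m1 * m3 * (((l1 * k3 - k1 * l3) * (l1 * k3 - k1 * l3)) / (l1 * k1 * (l3 * k3)))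
       + m2 * m3 * (((l2 * k3 - k2 * l3) * (l2 * k3 - k2 * l3)) / (l2 * k2 * (l3 * k3))))
      / ((m1 + m2 + m3) * (m1 + m2 + m3)).
Proof. intros. field. repeat split; auto. Qed.

Lemma sin_inner_angle_sq (a : config) : (forall k, side a k <> 0) ->
  (sin (inner_angle a B1) ^ 2 = v2cross (side a B2) (side a B3) ^ 2
      / (v2dot (side a B2) (side a B2) * v2dot (side a B3) (side a B3)))%R /\
  (sin (inner_angle a B2) ^ 2 = v2cross (side a B1) (side a B3) ^ 2
      / (v2dot (side a B1) (side a B1) * v2dot (side a B3) (side a B3)))%R /\
  (sin (inner_angle a B3) ^ 2 = v2cross (side a B1) (side a B2) ^ 2
      / (v2dot (side a B1) (side a B1) * v2dot (side a B2) (side a B2)))%R.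
Proof.
intros Hs.
assert (Opp : forall x y : C, x - y <> 0 -> y - x <> 0).
{ intros x y Hxy E. apply Hxy. replace (x - y) with (- (y - x)) by ring. rewrite E. ring. }
assert (S1 := Hs B1). assert (S2 := Hs B2). assert (S3 := Hs B3). simpl in S1, S2, S3.
unfold inner_angle.
split; [|split]; (rewrite sin_angle_sq; [|try assumption; now apply Opp..]);
 unfold v2cross, v2dot, v2sub, side, Rdiv; simpl; (apply f_equal2; [ring | apply f_equal; ring]).
Qed.

(** By [v2cross_sq_C] each fraction in [shear_norm_identity] equals -4 sin^2 of an inner angle, so
    |u|^2 = 1 - 4 S / M^2, where S is the weighted sum of squared sines and beta = 36 S / M^2. *)
Lemma beta_shear (m : body -> R) (a : config) :
  (forall i, (0 < m i)%R) -> (forall k, side a k <> 0) ->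
  (beta m a = 9 * (1 - Cmod (shear m a) ^ 2))%R.
Proof.
intros Hm Hs.
assert (S1 := Hs B1). assert (S2 := Hs B2). assert (S3 := Hs B3).
destruct (sin_inner_angle_sq a Hs) as [E1 [E2 E3]].
unfold beta. rewrite E1, E2, E3. clear E1 E2 E3.
assert (T : (0 < total m)%R) by (unfold total; generalize (Hm B1) (Hm B2) (Hm B3); lra).
fold (total m).
assert (D : forall k, (0 < v2dot (side a k) (side a k))%R).
{ intros k. rewrite <- v2norm_sq. generalize (v2norm_pos _ (Hs k)). nra. }
apply RtoC_inj.
rewrite RtoC_mult, RtoC_minus, Cmod2_conj.
rewrite RtoC_div by (apply Rgt_not_eq; nra).
replace (total m ^ 2)%R with (total m * total m)%R by ring.
rewrite !RtoC_mult, !RtoC_plus, !RtoC_mult.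
rewrite !RtoC_div by (apply Rgt_not_eq, Rmult_lt_0_compat; auto).
rewrite !RtoC_mult, !v2dot_self_C.
assert (X : forall u w : C, RtoC (v2cross u w ^ 2) = (u * Cconj w - Cconj u * w) * (u * Cconj w - Cconj u * w) / (-4)).
{ intros. rewrite <- v2cross_sq_C. field. }
rewrite !X.
assert (HT : RtoC (total m) = m B1 + m B2 + m B3) by (unfold total; now rewrite !RtoC_plus).
assert (M : RtoC (total m) <> 0) by (apply RtoC_neq_0; lra).
assert (Hd : forall k, Cconj (dirsq (side a k)) = Cconj (side a k) / side a k).
{ intros k. unfold dirsq. rewrite Cdiv_conj, Cconj_conj; auto. now apply Cconj_neq_0. }
unfold shear.
rewrite Cdiv_conj, Copp_conj, !Cplus_conj, !Cmult_conj, !Hd, !Cconj_RtoC by auto.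
unfold dirsq.
rewrite HT in *.
rewrite shear_norm_identity by (auto; now apply Cconj_neq_0).
field. repeat split; auto; now apply Cconj_neq_0.
Qed.

Lemma beta_range (m : body -> R) (a : config) :
  (forall i, (0 < m i)%R) -> (forall k, side a k <> 0) -> (0 <= beta m a <= 9)%R.
Proof.
intros Hm Hs. split.
- unfold beta. assert (P : forall i j, (0 < m i * m j)%R) by (intros; apply Rmult_lt_0_compat; auto).
  apply Rmult_le_pos.
  + generalize (P B1 B2) (P B1 B3) (P B2 B3) (pow2_ge_0 (sin (inner_angle a B1)))
     (pow2_ge_0 (sin (inner_angle a B2))) (pow2_ge_0 (sin (inner_angle a B3))). intros.
    assert (forall x y, 0 < x -> 0 <= y -> 0 <= x * y)%R by (intros; nra).
    generalize (H5 _ _ H H4) (H5 _ _ H0 H3) (H5 _ _ H1 H2). lra.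
  + apply Rlt_le, Rinv_0_lt_compat, pow_lt. generalize (Hm B1) (Hm B2) (Hm B3); lra.
- rewrite beta_shear by auto. generalize (pow2_ge_0 (Cmod (shear m a))). lra.
Qed.

(** * Homogeneity of the force and the side lengths of a central configuration *)

Lemma force_scal c (z : C) (a : body -> C) (i : body) : z <> 0 ->
  force c (fun j => z * a j) i = z * RtoC (/ v2norm z ^ 3) * force c a i.
Proof.
intros Hz. unfold force. rewrite !sum_other_C.
assert (P : forall i j, v2scal (c i j / v2norm (v2sub (z * a j) (z * a i)) ^ 3) (v2sub (z * a j) (z * a i))
   = z * RtoC (/ v2norm z ^ 3) * v2scal (c i j / v2norm (v2sub (a j) (a i)) ^ 3) (v2sub (a j) (a i))).
{ intros i' j. change v2sub with Cminus. rewrite !v2scal_C.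
  replace (z * a j - z * a i') with (z * (a j - a i')) by ring.
  replace (c i' j / v2norm (z * (a j - a i'))%C ^ 3)%R with (/ v2norm z ^ 3 * (c i' j / v2norm (a j - a i')%C ^ 3))%R.
  - rewrite RtoC_mult. C_eq. ring.
  - rewrite !v2norm_Cmod, Cmod_mult. unfold Rdiv. rewrite Rpow_mult_distr, Rinv_mult. ring. }
destruct i; rewrite !P; C_eq; ring.
Qed.

Local Close Scope C_scope.

Lemma v2_independent (p q : R) (u w : vec) :
  v2cross u w <> 0 -> v2add (v2scal p u) (v2scal q w) = (0, 0) -> p = 0 /\ q = 0.
Proof.
intros H E. destruct u as [u1 u2], w as [w1 w2]. unfold v2cross in H. simpl in H.
injection E; simpl; intros E2 E1.
split; apply (Rmult_eq_reg_r (u1 * w2 - u2 * w1)); auto; rewrite Rmult_0_l.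
- transitivity ((p * u1 + q * w1) * w2 - (p * u2 + q * w2) * w1); [ring|]. rewrite E1, E2. ring.
- transitivity ((p * u2 + q * w2) * u1 - (p * u1 + q * w1) * u2); [ring|]. rewrite E1, E2. ring.
Qed.

(** Write k_ij for the quotient to be determined. Once the center of mass is known to be the origin,
    the equation of body i reads sum_j (k_ij - mu m_i m_j / M) (a_j - a_i) = 0. Its two vectors are
    independent by non-collinearity, so both coefficients vanish. *)
Lemma cc_shape (m : body -> R) c (mu : R) (a : config) :
  (forall i, 0 < m i) -> (forall i j, c i j = c j i) -> mu <> 0 ->
  v2cross (v2sub (a B2) (a B1)) (v2sub (a B3) (a B1)) <> 0 ->
  (forall i, force c a i = v2scal (- mu * m i) (a i)) ->
  (m B1 * a B1 + m B2 * a B2 + m B3 * a B3)%C = 0 /\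
  forall i j, i <> j -> c i j / v2norm (v2sub (a j) (a i)) ^ 3 = mu * m i * m j / total m.
Proof.
intros Hm Hc Hmu Hx HF.
set (k := fun i j => c i j / v2norm (v2sub (a j) (a i)) ^ 3).
assert (Hk : forall i j, k i j = k j i).
{ intros i j. unfold k. rewrite Hc.
  replace (v2norm (v2sub (a j) (a i))) with (v2norm (v2sub (a i) (a j))); auto.
  unfold v2norm. f_equal. unfold v2dot, v2sub. simpl. ring. }
assert (HF' : forall i, sum_other i (fun j => v2scal (k i j) (v2sub (a j) (a i))) = v2scal (- mu * m i) (a i)) by apply HF.
assert (T : 0 < total m) by (unfold total; generalize (Hm B1) (Hm B2) (Hm B3); lra).
generalize (HF' B1) (HF' B2) (HF' B3).
unfold sum_other. simpl. rewrite (Hk B2 B1), (Hk B3 B1), (Hk B3 B2).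
intros F1 F2 F3.
injection F1; injection F2; injection F3. simpl. clear F1 F2 F3. intros F3y F3x F2y F2x F1y F1x.
destruct (a B1) as [x1 y1] eqn:A1, (a B2) as [x2 y2] eqn:A2, (a B3) as [x3 y3] eqn:A3. simpl in *.
(* In the sum of the three equations the internal forces cancel in pairs. *)
assert (Cx : m B1 * x1 + m B2 * x2 + m B3 * x3 = 0).
{ apply (Rmult_eq_reg_l mu); auto. lra. }
assert (Cy : m B1 * y1 + m B2 * y2 + m B3 * y3 = 0).
{ apply (Rmult_eq_reg_l mu); auto. lra. }
split.
{ apply injective_projections; simpl; lra. }
assert (Mix : forall k1 k2 mi mj ml xi xj xl, k1 * (xj - xi) + k2 * (xl - xi) = - mu * mi * xi ->
  mi * xi + mj * xj + ml * xl = 0 -> total m = mi + mj + ml ->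
  (k1 - mu * mi * mj / total m) * (xj - xi) + (k2 - mu * mi * ml / total m) * (xl - xi) = 0).
{ intros k1 k2 mi mj ml xi xj xl F Cm Tm.
  transitivity (k1 * (xj - xi) + k2 * (xl - xi) + mu * mi * xi - mu * mi / total m * (mi * xi + mj * xj + ml * xl)).
  - rewrite Tm in *. field. lra.
  - rewrite F, Cm. ring. }
(* Body 1 determines the pairs 12 and 13, and body 2 the pair 23; symmetry of k gives the reversed
   pairs. *)
assert (K1 : k B1 B2 - mu * m B1 * m B2 / total m = 0 /\ k B1 B3 - mu * m B1 * m B3 / total m = 0).
{ apply (v2_independent _ _ (v2sub (x2, y2) (x1, y1)) (v2sub (x3, y3) (x1, y1))); auto.
  apply injective_projections; simpl; apply Mix; unfold total; lra. }
assert (K2 : k B1 B2 - mu * m B2 * m B1 / total m = 0 /\ k B2 B3 - mu * m B2 * m B3 / total m = 0).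
{ apply (v2_independent _ _ (v2sub (x1, y1) (x2, y2)) (v2sub (x3, y3) (x2, y2))); auto.
  - unfold v2cross in *; simpl in *; lra.
  - apply injective_projections; simpl; apply Mix; unfold total; lra. }
destruct K1, K2.
intros i j Hij. fold (k i j).
destruct i, j; try congruence; rewrite ?(Hk B2 B1), ?(Hk B3 B1), ?(Hk B3 B2);
  unfold Rdiv in *; lra.
Qed.

(** * Kepler orbits of equal eccentricity *)

Lemma vderiv_unique (f g h : R -> vec) : vderiv f g -> vderiv f h -> forall t, g t = h t.
Proof.
intros G H t. destruct (G t) as [G1 G2], (H t) as [H1 H2].
apply injective_projections.
- apply is_derive_unique in G1. apply is_derive_unique in H1. congruence.
- apply is_derive_unique in G2. apply is_derive_unique in H2. congruence.
Qed.

Lemma vderiv_ext (f g f' g' : R -> vec) :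
  (forall t, f t = g t) -> (forall t, f' t = g' t) -> vderiv f f' -> vderiv g g'.
Proof.
intros H H' D. rewrite <- (functional_extensionality _ _ H), <- (functional_extensionality _ _ H'). exact D.
Qed.

Lemma vderiv_plus (f g f' g' : R -> C) : vderiv f f' -> vderiv g g' ->
  vderiv (fun t => f t + g t)%C (fun t => f' t + g' t)%C.
Proof.
intros F G t. destruct (F t) as [F1 F2], (G t) as [G1 G2].
split; apply @is_derive_plus; auto.
Qed.

Lemma vderiv_minus (f g f' g' : R -> vec) : vderiv f f' -> vderiv g g' ->
  vderiv (fun t => v2sub (f t) (g t)) (fun t => v2sub (f' t) (g' t)).
Proof.
intros F G t. destruct (F t) as [F1 F2], (G t) as [G1 G2].
split; apply @is_derive_minus; auto.
Qed.

Lemma is_derive_Rmult (f g : R -> R) (t f' g' : R) : is_derive f t f' -> is_derive g t g' ->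
  is_derive (fun s => f s * g s) t (f' * g t + f t * g').
Proof. intros F G. apply (is_derive_mult f g t f' g' F G). apply Rmult_comm. Qed.

Lemma is_derive_v2dot (f g f' g' : R -> vec) (t : R) : vderiv f f' -> vderiv g g' ->
  is_derive (fun t => v2dot (f t) (g t)) t (v2dot (f' t) (g t) + v2dot (f t) (g' t)).
Proof.
intros F G. destruct (F t) as [F1 F2], (G t) as [G1 G2]. unfold v2dot.
replace (fst (f' t) * fst (g t) + snd (f' t) * snd (g t) + (fst (f t) * fst (g' t) + snd (f t) * snd (g' t)))
 with ((fst (f' t) * fst (g t) + fst (f t) * fst (g' t)) + (snd (f' t) * snd (g t) + snd (f t) * snd (g' t))) by ring.
apply @is_derive_plus; apply is_derive_Rmult; auto.
Qed.

Lemma vderiv_mult (c : C) (f f' : R -> C) : vderiv f f' ->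
  vderiv (fun t => c * f t)%C (fun t => c * f' t)%C.
Proof.
intros F t. destruct (F t) as [F1 F2]. split; simpl.
- apply @is_derive_minus; apply is_derive_scal; auto.
- apply @is_derive_plus; apply is_derive_scal; auto.
Qed.

Lemma vderiv_conj (f f' : R -> C) : vderiv f f' ->
  vderiv (fun t => Cconj (f t)) (fun t => Cconj (f' t)).
Proof.
intros F t. destruct (F t) as [F1 F2]. split; simpl; auto.
now apply @is_derive_opp.
Qed.

Lemma vderiv_affine (f f' : R -> C) (al t0 t1 : R) : vderiv f f' ->
  vderiv (fun t => f (al * (t - t0) + t1)%R) (fun t => RtoC al * f' (al * (t - t0) + t1)%R)%C.
Proof.
intros F t. destruct (F (al * (t - t0) + t1)) as [F1 F2].
assert (A : is_derive (fun t => al * (t - t0) + t1) t al) by (auto_derive; auto; ring).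
split; simpl.
- replace (al * fst (f' (al * (t - t0) + t1)) - 0 * snd (f' (al * (t - t0) + t1)))
    with (al * fst (f' (al * (t - t0) + t1))) by ring.
  exact (is_derive_comp (fun s => fst (f s)) _ t _ _ F1 A).
- replace (al * snd (f' (al * (t - t0) + t1)) + 0 * fst (f' (al * (t - t0) + t1)))
    with (al * snd (f' (al * (t - t0) + t1))) by ring.
  exact (is_derive_comp (fun s => snd (f s)) _ t _ _ F2 A).
Qed.

(** * Gronwall's lemma and uniqueness for the Kepler equation *)

Lemma is_derive_nonneg_mono (G G' : R -> R) (a b : R) :
  (forall t, is_derive G t (G' t)) -> (forall t, 0 <= G' t) -> a <= b -> G a <= G b.
Proof.
intros D P [H| ->]; [|lra].
destruct (MVT_gen G a b G') as [c [_ Hc]].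
- intros; apply D.
- intros x _. apply continuity_pt_filterlim, (ex_derive_continuous G). eexists; apply D.
- generalize (P c). nra.
Qed.

(** After t0 the function E exp(-Kt) is nonincreasing, before t0 the function E exp(Kt) is
    nondecreasing. Both are nonnegative and vanish at t0. *)
Lemma gronwall_zero (E E' : R -> R) (K t0 : R) :
  (forall t, is_derive E t (E' t)) -> (forall t, 0 <= E t) ->
  (forall t, Rabs (E' t) <= K * E t) -> E t0 = 0 -> forall t, E t = 0.
Proof.
intros D P B Z t.
assert (B' : forall t, - (K * E t) <= E' t <= K * E t) by (intros; apply Rabs_le_between, B).
assert (Ex : forall x, 0 < exp x) by apply exp_pos.
destruct (Rle_dec t0 t) as [L|L].
- assert (H := is_derive_nonneg_mono (fun s => - (E s * exp (- K * s)))
    (fun s => (K * E s - E' s) * exp (- K * s)) t0 t).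
  simpl in H. rewrite Z in H.
  assert (- (0 * exp (- K * t0)) <= - (E t * exp (- K * t))).
  { apply H; auto.
    - intros s. assert (Ds := D s). auto_derive; [eexists; apply Ds|].
      replace (Derive (fun x => E x) s) with (E' s) by (symmetry; apply is_derive_unique, Ds). ring.
    - intros s. apply Rmult_le_pos; [specialize (B' s); lra|]. apply Rlt_le, Ex. }
  specialize (P t). specialize (Ex (- K * t)). nra.
- assert (H := is_derive_nonneg_mono (fun s => E s * exp (K * s))
    (fun s => (K * E s + E' s) * exp (K * s)) t t0).
  simpl in H. rewrite Z in H.
  assert (E t * exp (K * t) <= 0 * exp (K * t0)).
  { apply H; try lra.
    - intros s. assert (Ds := D s). auto_derive; [eexists; apply Ds|].
      replace (Derive (fun x => E x) s) with (E' s) by (symmetry; apply is_derive_unique, Ds). ring.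
    - intros s. apply Rmult_le_pos; [specialize (B' s); lra|]. apply Rlt_le, Ex. }
  specialize (P t). specialize (Ex (K * t)). nra.
Qed.

Definition kepler_sol (mu : R) (z v : R -> C) : Prop :=
  (forall t, z t <> 0) /\ vderiv z v /\
  vderiv v (fun t => v2scal (- mu / (v2norm (z t)) ^ 3) (z t)).

(** Split the difference as (y - z)/|y|^3 + (|y|^-3 - |z|^-3) z. The first term contributes 1/p^3 to
    the constant; factoring |y| - |z| out of the second leaves three products of inverse norms,
    which contribute 3/p^3. *)
Lemma inverse_square_lipschitz (p : R) (y z : C) :
  0 < p -> p <= Cmod y -> p <= Cmod z ->
  Cmod (RtoC (/ Cmod y ^ 3) * y - RtoC (/ Cmod z ^ 3) * z)%C <= 4 / p ^ 3 * Cmod (y - z)%C.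
Proof.
intros Hp Hy Hz.
set (A := Cmod y) in *. set (B := Cmod z) in *.
replace (RtoC (/ A ^ 3) * y - RtoC (/ B ^ 3) * z)%C
  with (RtoC (/ A ^ 3) * (y - z) + RtoC (/ A ^ 3 - / B ^ 3) * z)%C by (rewrite RtoC_minus; ring).
eapply Rle_trans; [apply Cmod_triangle|].
rewrite !Cmod_mult, !Cmod_R. fold B.
assert (L : Rabs (A - B) <= Cmod (y - z)%C).
{ apply Rabs_le_between. split.
  - generalize (Cmod_triangle y (z - y)%C). replace (y + (z - y))%C with z by ring. fold A B.
    replace (z - y)%C with (- (y - z))%C by ring. rewrite Cmod_opp. lra.
  - generalize (Cmod_triangle z (y - z)%C). replace (z + (y - z))%C with y by ring. fold A B. lra. }
set (D := Cmod (y - z)%C) in *.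
assert (HD : 0 <= D) by apply Cmod_ge_0.
assert (IA : 0 < / A <= / p) by (split; [apply Rinv_0_lt_compat; lra | apply Rinv_le_contravar; lra]).
assert (IB : 0 < / B <= / p) by (split; [apply Rinv_0_lt_compat; lra | apply Rinv_le_contravar; lra]).
replace (Rabs (/ A ^ 3 - / B ^ 3) * B) with (Rabs (A - B) * (/ A * (/ A * / A + / A * / B + / B * / B))).
2:{ replace (/ A ^ 3 - / B ^ 3) with (- (A - B) * (/ A * (/ A * / A + / A * / B + / B * / B)) * / B) by (field; lra).
    rewrite (Rabs_mult (_ * _) (/ B)), (Rabs_mult (- (A - B))), Rabs_Ropp, (Rabs_right (/ B)) by lra.
    rewrite (Rabs_right (/ A * _)); [field; lra|].
    apply Rle_ge, Rmult_le_pos; [lra|]. nra. }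
replace (/ A ^ 3) with (/ A * / A * / A) by (field; lra).
replace (4 / p ^ 3) with (4 * (/ p * / p * / p)) by (field; lra).
set (x := / A) in *. set (w := / B) in *. set (q := / p) in *.
rewrite (Rabs_right (x * x * x)) by (apply Rle_ge; repeat apply Rmult_le_pos; lra).
assert (M2 : forall a b, 0 < a <= q -> 0 < b <= q -> a * b <= q * q) by (intros; nra).
assert (M3 : forall a b c, 0 < a <= q -> 0 < b <= q -> 0 < c <= q -> a * (b * c) <= q * (q * q)).
{ intros a b c Ha Hb Hc. apply Rmult_le_compat; [lra| nra | lra | apply M2; auto]. }
assert (x * x * x <= q * q * q) by (generalize (M3 x x x IA IA IA); lra).
assert (x * (x * x + x * w + w * w) <= 3 * (q * q * q)).
{ generalize (M3 x x x IA IA IA) (M3 x x w IA IA IB) (M3 x w w IA IB IB). lra. }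
assert (0 <= x * (x * x + x * w + w * w)) by (apply Rmult_le_pos; nra).
assert (0 <= Rabs (A - B)) by apply Rabs_pos.
assert (Rabs (A - B) * (x * (x * x + x * w + w * w)) <= D * (3 * (q * q * q))).
{ apply Rmult_le_compat; lra. }
assert (x * x * x * D <= q * q * q * D) by (apply Rmult_le_compat_r; lra).
lra.
Qed.

(** Both orbits avoid the disk of radius p, outside which the force is Lipschitz with constant K.
    Gronwall applies to E, the squared distance of the two solutions in phase space, with |E'| <= (1
    + K) E. *)
Lemma kepler_unique (mu p t0 : R) (y z v w : R -> C) :
  0 < mu -> 0 < p -> (forall t, p <= Cmod (y t)) -> (forall t, p <= Cmod (z t)) ->
  kepler_sol mu y v -> kepler_sol mu z w -> y t0 = z t0 -> v t0 = w t0 ->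
  forall t, y t = z t.
Proof.
intros Hmu Hp Py Pz [_ [Dy Dv]] [_ [Dz Dw]] E0 F0 t.
set (Fd := fun t => (v2sub (v2scal (- mu / (v2norm (y t)) ^ 3) (y t)) (v2scal (- mu / (v2norm (z t)) ^ 3) (z t)))).
set (d := fun t => v2sub (y t) (z t)). set (g := fun t => v2sub (v t) (w t)).
set (K := mu * (4 / p ^ 3)).
assert (HK : 0 < K).
{ unfold K. apply Rmult_lt_0_compat; auto. apply Rdiv_lt_0_compat; [lra|]. now apply pow_lt. }
assert (LF : forall t, v2dot (Fd t) (Fd t) <= K ^ 2 * v2dot (d t) (d t)).
{ intros s. rewrite <- !v2norm_sq.
  assert (L : v2norm (Fd s) <= K * v2norm (d s)).
  { change (Fd s) with (Fd s : C). change (d s) with (d s : C). rewrite !v2norm_Cmod.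
    replace (Fd s : C) with (RtoC (- mu) * (RtoC (/ Cmod (y s) ^ 3) * y s - RtoC (/ Cmod (z s) ^ 3) * z s))%C.
    - rewrite Cmod_mult, Cmod_R, Rabs_left by lra.
      replace (- - mu) with mu by ring. unfold K. rewrite Rmult_assoc. apply Rmult_le_compat_l; [lra|].
      apply inverse_square_lipschitz; auto.
    - unfold Fd. change v2sub with Cminus. rewrite !v2scal_C, !v2norm_Cmod. unfold Rdiv. rewrite !RtoC_mult.
      C_eq. ring. }
  assert (0 <= v2norm (Fd s)) by apply sqrt_pos.
  replace (K ^ 2 * (v2norm (d s) * v2norm (d s))) with ((K * v2norm (d s)) * (K * v2norm (d s))) by ring.
  apply Rmult_le_compat; auto. }
set (E := fun t => v2dot (d t) (d t) + v2dot (g t) (g t)).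
assert (Z : E t = 0).
{ apply (gronwall_zero E (fun t => 2 * v2dot (d t) (g t) + 2 * v2dot (g t) (Fd t)) (1 + K) t0).
  - intros s.
    assert (Dd := vderiv_minus _ _ _ _ Dy Dz). assert (Dg := vderiv_minus _ _ _ _ Dv Dw).
    replace (2 * v2dot (d s) (g s) + 2 * v2dot (g s) (Fd s))
      with ((v2dot (g s) (d s) + v2dot (d s) (g s)) + (v2dot (Fd s) (g s) + v2dot (g s) (Fd s)))
      by (unfold v2dot; ring).
    apply (@is_derive_plus R_AbsRing R_NormedModule); apply is_derive_v2dot; auto.
  - intros s. unfold E, v2dot. nra.
  - intros s. unfold E. specialize (LF s).
    assert (Q : forall x y : vec, Rabs (2 * v2dot x y) <= v2dot x x + v2dot y y).
    { intros x1 y1. unfold v2dot. apply Rabs_le_between.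
      generalize (Rle_0_sqr (fst x1 + fst y1)) (Rle_0_sqr (snd x1 + snd y1))
        (Rle_0_sqr (fst x1 - fst y1)) (Rle_0_sqr (snd x1 - snd y1)). unfold Rsqr. lra. }
    eapply Rle_trans; [apply Rabs_triang|].
    assert (Q1 := Q (d s) (g s)).
    (* The inequality [Q] is applied to K g and Fd, then divided by K, which balances the two terms
       against |Fd|^2 <= K^2 |d|^2. *)
    assert (Q2 : Rabs (2 * v2dot (g s) (Fd s)) <= K * (v2dot (d s) (d s) + v2dot (g s) (g s))).
    { assert (Q3 := Q (v2scal K (g s)) (Fd s)).
      replace (2 * v2dot (v2scal K (g s)) (Fd s)) with (K * (2 * v2dot (g s) (Fd s))) in Q3
        by (unfold v2dot; simpl; ring).
      replace (v2dot (v2scal K (g s)) (v2scal K (g s))) with (K ^ 2 * v2dot (g s) (g s)) in Q3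
        by (unfold v2dot; simpl; ring).
      rewrite Rabs_mult, (Rabs_right K) in Q3 by lra.
      apply (Rmult_le_reg_l K); auto. lra. }
    lra.
  - unfold E, d, g. rewrite E0, F0. unfold v2dot, v2sub. simpl. ring. }
unfold E, d, g, v2dot, v2sub in Z. simpl in Z.
assert (S : forall a b c e : R, a * a + b * b + (c * c + e * e) = 0 -> a = 0 /\ b = 0).
{ intros a b c e H. split; apply Rsqr_0_uniq; unfold Rsqr; nra. }
apply S in Z. apply injective_projections; lra.
Qed.

(** * Conservation of the eccentricity and existence of a pericenter *)

Lemma is_derive_v2norm (z v : R -> vec) (t : R) : vderiv z v -> z t <> (0, 0) ->
  is_derive (fun s => v2norm (z s)) t (v2dot (z t) (v t) / v2norm (z t)).
Proof.
intros D Hz. apply v2norm_pos in Hz.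
assert (Hd : 0 < v2dot (z t) (z t)) by (rewrite <- v2norm_sq; nra).
unfold v2norm at 1.
replace (v2dot (z t) (v t) / v2norm (z t)) with
  ((v2dot (v t) (z t) + v2dot (z t) (v t)) * / (2 * sqrt (v2dot (z t) (z t)))).
- apply (is_derive_comp sqrt).
  + apply is_derive_Reals, derivable_pt_lim_sqrt, Hd.
  + now apply is_derive_v2dot.
- unfold v2norm in *. unfold v2dot in *. field. lra.
Qed.

Lemma is_derive_zero_const (f : R -> R) : (forall t, is_derive f t 0) -> forall s t, f s = f t.
Proof.
intros D. assert (L : forall s t, s <= t -> f s = f t).
{ intros s t H. apply Rle_antisym.
  - apply (is_derive_nonneg_mono f (fun _ => 0)); auto. intros; lra.
  - apply Ropp_le_cancel, (is_derive_nonneg_mono (fun x => - f x) (fun _ => 0)); auto; [|intros; lra].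
    intros x. replace 0 with (- 0) by ring. now apply @is_derive_opp. }
intros s t. destruct (Rle_dec s t); [auto|]. symmetry. apply L. lra.
Qed.

(** The whole Laplace-Runge-Lenz vector [L] is conserved. This moves the eccentricity, prescribed at
    time 0, to the pericenter. *)
Lemma eccentricity_const (mu : R) (z v : R -> C) (s t : R) :
  0 < mu -> kepler_sol mu z v -> eccentricity mu (z s) (v s) = eccentricity mu (z t) (v t).
Proof.
intros Hmu [Hz [Dz Dv]]. unfold eccentricity. f_equal.
set (L := fun t => v2sub (v2scal (/ mu) (snd (v t) * v2cross (z t) (v t), - fst (v t) * v2cross (z t) (v t)))
                 (v2scal (/ v2norm (z t)) (z t))).
assert (D : forall t, is_derive (fun t => fst (L t)) t 0 /\ is_derive (fun t => snd (L t)) t 0).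
{ clear s t. intros t.
  assert (N0 := v2norm_pos _ (Hz t)).
  assert (N2 := v2norm_sq (z t)).
  assert (Dn := is_derive_v2norm z v t Dz (Hz t)).
  destruct (Dz t) as [Dz1 Dz2], (Dv t) as [Dv1 Dv2].
  assert (Di : is_derive (fun s => / v2norm (z s)) t (- (v2dot (z t) (v t) / v2norm (z t)) / v2norm (z t) ^ 2))
    by (apply is_derive_inv; auto; lra).
  (* Angular momentum is conserved because the force is central. *)
  assert (Dh : is_derive (fun s => v2cross (z s) (v s)) t 0).
  { unfold v2cross.
    assert (A := is_derive_Rmult _ _ _ _ _ Dz1 Dv2). assert (B := is_derive_Rmult _ _ _ _ _ Dz2 Dv1).
    assert (M := is_derive_minus _ _ _ _ _ A B). eapply (is_derive_ext); [|eapply eq_ind; [apply M|]].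
    - reflexivity.
    - unfold minus, plus, opp. simpl. ring. }
  unfold v2dot, v2cross in *.
  split; unfold L; simpl.
  - assert (A := is_derive_Rmult _ _ _ _ _ Dv2 Dh).
    assert (B := is_derive_Rmult _ _ _ _ _ Di Dz1).
    assert (A' := is_derive_scal _ _ (/ mu) _ A).
    assert (M := is_derive_minus _ _ _ _ _ A' B).
    eapply eq_ind; [apply M|].
    unfold minus, plus, opp, v2cross. simpl.
    set (n := v2norm (z t)) in *.
    transitivity ((- snd (z t) * (fst (z t) * snd (v t) - snd (z t) * fst (v t))
      + (fst (z t) * fst (v t) + snd (z t) * snd (v t)) * fst (z t) - n * n * fst (v t)) / n ^ 3).
    + field. lra.
    + rewrite N2. field. lra.
  - assert (Dv1' := is_derive_opp _ _ _ Dv1). assert (A := is_derive_Rmult _ _ _ _ _ Dv1' Dh).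
    assert (B := is_derive_Rmult _ _ _ _ _ Di Dz2).
    assert (A' := is_derive_scal _ _ (/ mu) _ A).
    assert (M := is_derive_minus _ _ _ _ _ A' B).
    eapply eq_ind; [apply M|].
    unfold minus, plus, opp, v2cross. simpl.
    set (n := v2norm (z t)) in *.
    transitivity ((fst (z t) * (fst (z t) * snd (v t) - snd (z t) * fst (v t))
      + (fst (z t) * fst (v t) + snd (z t) * snd (v t)) * snd (z t) - n * n * snd (v t)) / n ^ 3).
    + field. lra.
    + rewrite N2. field. lra. }
apply (injective_projections (L s) (L t)).
- apply (is_derive_zero_const (fun t => fst (L t))). intros x; apply D.
- apply (is_derive_zero_const (fun t => snd (L t))). intros x; apply D.
Qed.

Lemma periodic_IZR (A : Type) (f : R -> A) (T : R) :
  (forall t, f (t + T) = f t) -> forall k t, f (t + IZR k * T) = f t.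
Proof.
intros P. assert (N : forall n t, f (t + INR n * T) = f t).
{ induction n; intros t.
  - f_equal. simpl. ring.
  - rewrite S_INR. replace (t + (INR n + 1) * T) with ((t + INR n * T) + T) by ring. rewrite P. auto. }
intros k t. destruct (Z_le_dec 0 k) as [H|H].
- rewrite <- (Z2Nat.id k H), <- INR_IZR_INZ. auto.
- rewrite <- (N (Z.to_nat (- k)) (t + IZR k * T)). f_equal.
  rewrite INR_IZR_INZ, Z2Nat.id, opp_IZR; [ring | lia].
Qed.

Lemma periodic_continuous_min (f : R -> R) (T : R) :
  0 < T -> (forall t, f (t + T) = f t) -> (forall t, continuity_pt f t) ->
  exists t0, forall t, f t0 <= f t.
Proof.
intros HT P Cf.
destruct (continuity_ab_min f 0 T) as [t0 [H0 _]]; [lra|auto|].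
exists t0. intros t.
destruct (euclidian_division t T) as [k [r [-> Hr]]]; [lra|].
rewrite Rabs_right in Hr by lra.
replace (IZR k * T + r) with (r + IZR k * T) by ring.
rewrite (periodic_IZR _ f T P). apply H0. lra.
Qed.

(** If l were negative, g would be negative just to the right of t0, and the mean value theorem
    would give a value of f below the minimum. *)
Lemma min_second_derivative (f g : R -> R) (t0 l : R) :
  (forall t, is_derive f t (g t)) -> is_derive g t0 l -> (forall t, f t0 <= f t) ->
  g t0 = 0 /\ 0 <= l.
Proof.
intros D Dg M.
assert (D' : forall t, derivable_pt_lim f t (g t)) by (intros; apply is_derive_Reals, D).
assert (G0 : g t0 = 0).
{ change (g t0) with (derive_pt f t0 (exist _ (g t0) (D' t0))).
  apply deriv_minimum with (a := t0 - 1) (b := t0 + 1); intros; auto; lra. }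
split; auto.
apply is_derive_Reals in Dg.
destruct (Rle_dec 0 l) as [|H]; auto. exfalso.
(* With tolerance -l/2 the difference quotient of g stays below l/2, hence negative. *)
destruct (Dg (- l / 2)) as [[d Hd] Q]; [lra|]. simpl in Q.
destruct (MVT_cor2 f g t0 (t0 + d / 2)) as [c [E Hc]]; [lra|auto|].
specialize (Q (c - t0)). rewrite Rabs_right in Q by lra.
assert (B := Q ltac:(lra) ltac:(lra)). rewrite G0, Rminus_0_r in B.
replace (t0 + (c - t0)) with c in B by ring.
apply Rabs_def2 in B. destruct B as [B _].
assert (g c = g c / (c - t0) * (c - t0)) by (field; lra).
specialize (M (t0 + d / 2)).
assert (g c < 0) by nra. nra.
Qed.

(* The second-derivative test at the minimum of |z|^2 selects the sign in
   s^2 |z|^3 = mu (1 + e); at an apocenter it would be mu (1 - e). *)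
Lemma pericenter_exists (mu e T : R) (z v : R -> C) :
  0 < mu -> 0 < T -> kepler_sol mu z v -> (forall t, z (t + T) = z t) ->
  eccentricity mu (z 0) (v 0) = e ->
  exists tp s, (forall t, Cmod (z tp) <= Cmod (z t)) /\
    v tp = (RtoC s * Ci * z tp)%C /\ s ^ 2 * Cmod (z tp) ^ 3 = mu * (1 + e).
Proof.
intros Hmu HT K P He. destruct (K) as [Hz [Dz Dv]].
assert (Df := fun t => is_derive_v2dot z z v v t Dz Dz).
destruct (periodic_continuous_min (fun t => v2dot (z t) (z t)) T) as [tp Hmin]; auto.
{ intros t. now rewrite P. }
{ intros t. apply continuity_pt_filterlim, (ex_derive_continuous (fun t => v2dot (z t) (z t))). eexists; apply Df. }
exists tp.
assert (Dg1 := is_derive_v2dot v z _ v tp Dv Dz). assert (Dg2 := is_derive_v2dot z v v _ tp Dz Dv).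
destruct (min_second_derivative _ _ tp _ Df (is_derive_plus _ _ _ _ _ Dg1 Dg2) Hmin) as [M1 M2].
clear Dg1 Dg2. unfold plus in M2. simpl in M2.
(* From here on the eccentricity is computed at [tp]. *)
rewrite (eccentricity_const mu z v 0 tp Hmu K) in He.
assert (N0 := v2norm_pos _ (Hz tp)). assert (N2 := v2norm_sq (z tp)).
(* The angular velocity at the pericenter. *)
set (s := v2cross (z tp) (v tp) / v2dot (z tp) (z tp)).
assert (Hd : 0 < v2dot (z tp) (z tp)) by (rewrite <- N2; nra).
(* The first-order condition z.v = 0 makes the velocity perpendicular to the position. *)
assert (V : v tp = (RtoC s * Ci * z tp)%C).
{ assert (Hs : s * v2dot (z tp) (z tp) = v2cross (z tp) (v tp)) by (unfold s; field; lra).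
  clearbody s. unfold v2dot, v2cross in *.
  set (x := fst (z tp)) in *. set (y := snd (z tp)) in *.
  set (p := fst (v tp)) in *. set (q := snd (v tp)) in *.
  assert (O : x * p + y * q = 0) by lra.
  apply injective_projections; simpl; fold x y p q; apply (Rmult_eq_reg_r (x * x + y * y)); try lra.
  - transitivity (x * (x * p + y * q) - y * (x * q - y * p)); [ring|]. rewrite O, <- Hs. ring.
  - transitivity (y * (x * p + y * q) + x * (x * q - y * p)); [ring|]. rewrite O, <- Hs. ring. }
exists s. split; [|split; [exact V|]].
{ intros t. rewrite <- !v2norm_Cmod. apply sqrt_le_1_alt, Hmin. }
rewrite <- v2norm_Cmod. clearbody s. clear Hmin Df M1 P K Dz Dv Hz.
rewrite V in He, M2. clear V.
set (n := v2norm (z tp)) in *.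
(* The second-order condition |v|^2 >= mu/|z|, with |v| = |s| n. *)
assert (M2' : mu <= s ^ 2 * n ^ 3).
{ unfold v2dot in M2, N2. simpl in M2. fold n in M2.
  assert (Q : (s ^ 2 - mu / n ^ 3) * (n * n) = (s * s * (n * n) - mu / (n * (n * (n * 1))) * (n * n))) by (field; lra).
  assert (Q2 : 0 <= (s ^ 2 - mu / n ^ 3) * (n * n)) by (rewrite Q, N2; lra).
  assert (0 <= s ^ 2 - mu / n ^ 3) by (apply (Rmult_le_reg_r (n * n)); nra).
  assert (n ^ 3 * (mu / n ^ 3) = mu) by (field; lra).
  assert (L : 0 < n ^ 3) by (apply pow_lt; auto).
  assert (L' : 0 <= (s ^ 2 - mu / n ^ 3) * n ^ 3) by (apply Rmult_le_pos; lra).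
  rewrite Rmult_minus_distr_r in L'. lra. }
unfold eccentricity in He.
(* For v = s i z the Laplace-Runge-Lenz vector is a real multiple of z, of norm |s^2 n^3 - mu| / mu;
   [M2'] removes the absolute value. *)
match type of He with v2norm ?x = _ => replace x with (v2scal (s ^ 2 * n ^ 2 / mu - / n) (z tp)) in He end.
- change (v2scal (s ^ 2 * n ^ 2 / mu - / n) (z tp)) with (v2scal (s ^ 2 * n ^ 2 / mu - / n) (z tp) : C) in He.
  rewrite v2norm_Cmod, v2scal_C, Cmod_mult, Cmod_R, <- v2norm_Cmod in He. fold n in He.
  assert (E : s ^ 2 * n ^ 2 / mu - / n = (s ^ 2 * n ^ 3 - mu) * / (mu * n)) by (field; lra).
  rewrite Rabs_right in He.
  + rewrite <- He, E. field. lra.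
  + rewrite E. apply Rle_ge, Rmult_le_pos; [lra|]. apply Rlt_le, Rinv_0_lt_compat. nra.
- fold n. replace (s ^ 2 * n ^ 2) with (s ^ 2 * (n * n)) by ring. rewrite N2. unfold v2dot, v2cross.
  apply injective_projections; simpl; field; lra.
Qed.

(** * Similarity of Kepler orbits, up to a reflection *)

Definition cflip (b : bool) (x : C) : C := if b then Cconj x else x.

Lemma cflip_plus b (x y : C) : cflip b (x + y)%C = (cflip b x + cflip b y)%C.
Proof. destruct b; simpl; auto. apply Cplus_conj. Qed.
Lemma cflip_minus b (x y : C) : cflip b (x - y)%C = (cflip b x - cflip b y)%C.
Proof. destruct b; simpl; auto. apply Cminus_conj. Qed.
Lemma cflip_mult b (x y : C) : cflip b (x * y)%C = (cflip b x * cflip b y)%C.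
Proof. destruct b; simpl; auto. apply Cmult_conj. Qed.
Lemma cflip_RtoC b (x : R) : cflip b x = x.
Proof. destruct b; simpl; auto. apply Cconj_RtoC. Qed.
Lemma cflip_cflip b (x : C) : cflip b (cflip b x) = x.
Proof. destruct b; simpl; auto. apply Cconj_conj. Qed.
Lemma cflip_conj b (x : C) : cflip b (Cconj x) = Cconj (cflip b x).
Proof. destruct b; auto. Qed.
Lemma Cmod_cflip b (x : C) : Cmod (cflip b x) = Cmod x.
Proof. destruct b; simpl; auto. apply Cmod_conj. Qed.
Lemma cflip_neq_0 b (x : C) : x <> 0 -> cflip b x <> 0.
Proof. destruct b; simpl; auto. apply Cconj_neq_0. Qed.
Lemma vderiv_cflip b (f f' : R -> C) : vderiv f f' ->
  vderiv (fun t => cflip b (f t)) (fun t => cflip b (f' t)).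
Proof. destruct b; auto. apply vderiv_conj. Qed.

(** Pericenters are matched at t0 and t1: kap is the ratio of pericenter distances, g the remaining
    rotation, al the ratio of angular speeds. The two relations s^2 p^3 = mu (1 + e) give al^2 mu' =
    kap^3 mu. Both sides of the last equation then solve the Kepler equation with parameter kap^3
    mu, have the same data at t0, and stay at distance at least p' from the origin, so they
    coincide. *)
Lemma kepler_similar (mu mu' e T T' : R) (z v z' v' : R -> C) :
  0 < mu -> 0 < mu' -> 0 <= e -> 0 < T -> 0 < T' ->
  kepler_sol mu z v -> kepler_sol mu' z' v' ->
  (forall t, z (t + T) = z t) -> (forall t, z' (t + T') = z' t) ->
  eccentricity mu (z 0) (v 0) = e -> eccentricity mu' (z' 0) (v' 0) = e ->
  exists al t0 t1 kap b g, 0 < al /\ 0 < kap /\ Cmod g = 1 /\ al ^ 2 * mu' = kap ^ 3 * mu /\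
    forall t, z' (al * (t - t0) + t1) = (RtoC kap * g * cflip b (z t))%C.
Proof.
intros Hmu Hmu' He HT HT' K K' P P' Ee Ee'.
destruct (pericenter_exists mu e T z v) as [tp [s [Hp [Hv Hs]]]]; auto.
destruct (pericenter_exists mu' e T' z' v') as [tp' [s' [Hp' [Hv' Hs']]]]; auto.
assert (Z : z tp <> 0) by apply K. assert (Z' : z' tp' <> 0) by apply K'.
assert (N := proj1 (Cmod_gt_0 _) Z). assert (N' := proj1 (Cmod_gt_0 _) Z').
set (p := Cmod (z tp)) in *. set (p' := Cmod (z' tp')) in *.
assert (S0 : s <> 0).
{ intros ->. assert (0 < mu * (1 + e)) by (apply Rmult_lt_0_compat; lra). lra. }
assert (S0' : s' <> 0).
{ intros ->. assert (0 < mu' * (1 + e)) by (apply Rmult_lt_0_compat; lra). lra. }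
(* A reflection is inserted when s and s' have opposite signs, so that time is never reversed. *)
assert (B : exists b : bool, 0 < (if b then -1 else 1) * (s / s')).
{ assert (s / s' <> 0) by (apply Rmult_integral_contrapositive_currified; auto; now apply Rinv_neq_0_compat).
  destruct (Rle_dec 0 (s / s')); [exists false | exists true]; lra. }
destruct B as [b Hb]. set (sg := if b then -1 else 1) in *.
set (kap := p' / p). set (g := (z' tp' / (RtoC kap * cflip b (z tp)))%C).
set (al := sg * (s / s')) in *.
assert (Hk : 0 < kap) by (apply Rdiv_lt_0_compat; auto).
assert (Hg : Cmod g = 1).
{ unfold g. unfold Cdiv. rewrite Cmod_mult, Cmod_inv, Cmod_mult, Cmod_R, Cmod_cflip, Rabs_right.
  - fold p p'. unfold kap. field. lra.
  - lra.
  - apply Cmult_neq_0; [apply RtoC_neq_0; lra | now apply cflip_neq_0]. }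
assert (Hal : al ^ 2 * mu' = kap ^ 3 * mu).
{ assert (al ^ 2 = (s / s') ^ 2) by (unfold al, sg; destruct b; ring).
  rewrite H. unfold kap.
  apply (Rmult_eq_reg_r (1 + e)); [|lra].
  rewrite Rmult_assoc, <- Hs', Rmult_assoc, <- Hs. field. lra. }
exists al, tp, tp', kap, b, g. repeat (split; [assumption|]).
assert (HH : forall t, (RtoC kap * g * cflip b (z t))%C <> 0).
{ intros t. apply Cmult_neq_0; [apply Cmult_neq_0|].
  - apply RtoC_neq_0; lra.
  - intros E. rewrite E, Cmod_0 in Hg. lra.
  - apply cflip_neq_0, K. }
apply (kepler_unique (kap ^ 3 * mu) p' tp
  (fun t => z' (al * (t - tp) + tp')) (fun t => RtoC kap * g * cflip b (z t))%C
  (fun t => RtoC al * v' (al * (t - tp) + tp')%R)%C (fun t => RtoC kap * g * cflip b (v t))%C).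
- apply Rmult_lt_0_compat; auto. now apply pow_lt.
- auto.
- intros t. apply Hp'.
- intros t. rewrite !Cmod_mult, Hg, Cmod_R, Cmod_cflip, Rabs_right by lra.
  apply Rle_trans with (kap * p); [unfold kap; right; field; lra|].
  rewrite Rmult_1_r. apply Rmult_le_compat_l; [lra | apply Hp].
- split; [intros t; apply K'|]. split; [apply vderiv_affine, K'|].
  eapply vderiv_ext; [reflexivity| |apply vderiv_mult, vderiv_affine, K'].
  intros t. cbv beta. rewrite <- Hal, !v2scal_C.
  rewrite Cmult_assoc, Cmult_assoc, <- !RtoC_mult. f_equal. f_equal. unfold Rdiv. ring.
- split; [exact HH|]. split; [apply vderiv_mult, vderiv_cflip, K|].
  eapply vderiv_ext; [reflexivity| |apply vderiv_mult, vderiv_cflip, K].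
  intros t. cbv beta. rewrite !v2scal_C, cflip_mult, cflip_RtoC, !v2norm_Cmod.
  rewrite !Cmod_mult, Hg, Cmod_R, Cmod_cflip, Rabs_right by lra.
  assert (N1 : 0 < Cmod (z t)) by (apply Cmod_gt_0, K).
  replace (- (kap ^ 3 * mu) / (kap * 1 * Cmod (z t)) ^ 3) with (- mu / Cmod (z t) ^ 3) by (field; lra).
  C_eq. ring.
- rewrite Rminus_diag, Rmult_0_r, Rplus_0_l. unfold g. field. split.
  + now apply cflip_neq_0.
  + apply RtoC_neq_0; lra.
- rewrite Rminus_diag, Rmult_0_r, Rplus_0_l, Hv, Hv', !cflip_mult, cflip_RtoC.
  transitivity (RtoC (al * s') * Ci * z' tp')%C; [rewrite RtoC_mult; ring|].
  (* Conjugation turns [Ci] into [- Ci], so the initial velocities agree when al s' = sg s. *)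
  replace (al * s') with (sg * s) by (unfold al; field; auto).
  assert (Ec : cflip b Ci = (RtoC sg * Ci)%C).
  { unfold sg; destruct b; apply injective_projections; simpl; ring. }
  rewrite Ec, RtoC_mult. unfold g. field. split.
  + now apply cflip_neq_0.
  + apply RtoC_neq_0; lra.
Qed.

(** * Transformation of the linearized systems *)

(** Linearity is only over the reals because of conjugations. The second clause, commutation with
    differentiation along curves, is carried along so that it passes to sums, products and
    compositions. *)
Definition real_linear (F : config -> C) : Prop :=
  (forall s X Y, F (fun j => v2add (v2scal s (X j)) (Y j)) = v2add (v2scal s (F X)) (F Y)) /\
  (forall X X' : R -> config, (forall j, vderiv (fun t => X t j) (fun t => X' t j)) ->
     vderiv (fun t => F (X t)) (fun t => F (X' t))).

Lemma real_linear_proj k : real_linear (fun X => X k).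
Proof. split; auto. Qed.

Lemma real_linear_plus F G : real_linear F -> real_linear G -> real_linear (fun X => F X + G X)%C.
Proof.
intros [F1 F2] [G1 G2]. split.
- intros s X Y. rewrite F1, G1. apply injective_projections; simpl; ring.
- intros X X' D. apply vderiv_plus; auto.
Qed.

Lemma real_linear_mult_l c F : real_linear F -> real_linear (fun X => c * F X)%C.
Proof.
intros [F1 F2]. split.
- intros s X Y. rewrite F1. apply injective_projections; simpl; ring.
- intros X X' D. apply vderiv_mult; auto.
Qed.

Lemma real_linear_mult_r c F : real_linear F -> real_linear (fun X => F X * c)%C.
Proof.
intros HF. replace (fun X => F X * c)%C with (fun X => c * F X)%C.
- now apply real_linear_mult_l.
- apply functional_extensionality. intros; ring.
Qed.

Lemma real_linear_cflip b F : real_linear F -> real_linear (fun X => cflip b (F X)).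
Proof.
intros [F1 F2]. split.
- intros s X Y. rewrite F1. destruct b; simpl; auto. apply injective_projections; simpl; ring.
- intros X X' D. apply vderiv_cflip; auto.
Qed.

Lemma real_linear_comp F (G : config -> config) :
  real_linear F -> (forall k, real_linear (fun X => G X k)) -> real_linear (fun X => F (G X)).
Proof.
intros [F1 F2] HG. split.
- intros s X Y. rewrite <- F1. f_equal. apply functional_extensionality. intros k. apply HG.
- intros X X' D. apply (F2 (fun t => G (X t)) (fun t => G (X' t))). intros j. now apply HG.
Qed.

Ltac real_lin := repeat first
  [ apply real_linear_proj | apply real_linear_plus | apply real_linear_mult_l
  | apply real_linear_mult_r | apply real_linear_cflip ].

Lemma real_linear_assemble m a k : real_linear (fun X => assemble m a X k).
Proof. unfold assemble. real_lin. Qed.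

Lemma real_linear_coords m a k : real_linear (fun X => coords m a X k).
Proof. destruct k; unfold coords, Cdiv; real_lin. Qed.

(* Acts on the coordinates (x, y, w), stored at [B1], [B2], [B3]; [b] records whether the
   two orbits have opposite orientations. *)
Definition twist (b : bool) (g rho : C) (X : config) (k : body) : C :=
  match k with
  | B1 => X B1 | B2 => g * cflip b (X B2) | B3 => g * rho * cflip b (X B3)
  end%C.
Definition untwist (b : bool) (g rho : C) (X : config) (k : body) : C :=
  match k with
  | B1 => X B1 | B2 => cflip b (/ g * X B2) | B3 => cflip b (/ (g * rho) * X B3)
  end%C.

Lemma real_linear_twist b g rho k : real_linear (fun X => twist b g rho X k).
Proof. destruct k; unfold twist; real_lin. Qed.
Lemma real_linear_untwist b g rho k : real_linear (fun X => untwist b g rho X k).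
Proof. destruct k; unfold untwist; real_lin. Qed.

Lemma twist_untwist b (g rho : C) X k : g <> 0 -> rho <> 0 -> twist b g rho (untwist b g rho X) k = X k.
Proof. intros Hg Hr. destruct k; unfold twist, untwist; rewrite ?cflip_cflip; auto; C_eq; field; auto. Qed.
Lemma untwist_twist b (g rho : C) X k : g <> 0 -> rho <> 0 -> untwist b g rho (twist b g rho X) k = X k.
Proof.
intros Hg Hr. destruct k; unfold twist, untwist; auto.
- replace (/ g * (g * cflip b (X B2)))%C with (cflip b (X B2)) by (field; auto). apply cflip_cflip.
- replace (/ (g * rho) * (g * rho * cflip b (X B3)))%C with (cflip b (X B3)) by (field; auto). apply cflip_cflip.
Qed.

(** The equation asks rho to have half the argument of u/w. Since |u| = |w|, the sum u + w bisects
    the two directions, so (u + w) conj(w) works without a square root; the degenerate cases w = 0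
    and u = -w use 1 and i. *)
Lemma phase_exists (u w : C) : Cmod u = Cmod w -> exists rho : C, rho <> 0 /\ (Cconj rho * u = rho * w)%C.
Proof.
intros H.
destruct (Ceq_dec w 0) as [->|Hw].
- exists 1. split; [apply RtoC_neq_0; lra|]. rewrite Cmod_0 in H. rewrite (Cmod_eq_0 _ H). ring.
- destruct (Ceq_dec (u + w)%C 0) as [E|E].
  + exists Ci. split; [intros F; injection F; lra|].
    replace u with (- w)%C. { apply injective_projections; simpl; ring. }
    replace w with (u + w - u)%C at 1 by ring. rewrite E. ring.
  + exists ((u + w) * Cconj w)%C. split; [apply Cmult_neq_0; auto; now apply Cconj_neq_0|].
    rewrite Cmult_conj, Cplus_conj, Cconj_conj.
    assert (Q : (u * Cconj u = w * Cconj w)%C) by (rewrite <- !Cmod2_conj; now rewrite H).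
    transitivity (u * Cconj u * w + u * Cconj w * w)%C; [ring|]. rewrite Q. ring.
Qed.

(** The similarity of orbits gives Z' = g^2 [cflip b Z] and al^2 mu'/|z'|^3 = mu/|z|^3. In the
    conjugate terms g^2 conj(g) = g, and the choice of rho turns conj(rho) u' into rho
    [cflip b u]. *)
Lemma normal_rhs_twist (mu mu' al kap : R) (b : bool) (g rho z z' u u' : C) (X : config) (k : body) :
  z <> 0 -> 0 < kap -> Cmod g = 1 -> (al ^ 2 * mu' = kap ^ 3 * mu)%R ->
  (z' = RtoC kap * g * cflip b z)%C -> (Cconj rho * u' = rho * cflip b u)%C ->
  v2scal (al ^ 2) (normal_rhs (mu' / v2norm z' ^ 3) (dirsq z') u' (twist b g rho X) k)
  = twist b g rho (normal_rhs (mu / v2norm z ^ 3) (dirsq z) u X) k.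
Proof.
intros Hz Hk Hg Hal Ez Hr.
assert (Hgg : (g * Cconj g = 1)%C) by (rewrite <- Cmod2_conj, Hg; f_equal; ring).
assert (Hg0 : g <> 0) by (intros E; rewrite E, Cmod_0 in Hg; lra).
assert (Hgc := Cconj_neq_0 _ Hg0).
assert (Hzb := cflip_neq_0 b _ Hz). assert (Hzc := Cconj_neq_0 _ Hzb).
assert (Ed : dirsq z' = (g * g * cflip b (dirsq z))%C).
{ transitivity (g / Cconj g * (cflip b z / Cconj (cflip b z)))%C.
  - rewrite Ez. unfold dirsq. rewrite !Cmult_conj, Cconj_RtoC. field. repeat split; auto. apply RtoC_neq_0. lra.
  - replace (g / Cconj g)%C with (g * g)%C.
    + f_equal. unfold dirsq. destruct b; simpl; auto. rewrite Cdiv_conj; auto using Cconj_neq_0.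
    + transitivity (g * g * Cconj g / Cconj g)%C; [field; auto|].
      rewrite <- (Cmult_assoc g), Hgg. field. auto. }
assert (Ek : Cmult (RtoC (al ^ 2)) (RtoC (mu' / v2norm z' ^ 3)) = RtoC (mu / v2norm z ^ 3)).
{ rewrite <- RtoC_mult. f_equal. rewrite Ez, !v2norm_Cmod, !Cmod_mult, Hg, Cmod_cflip, Cmod_R, Rabs_right by lra.
  assert (0 < Cmod z) by now apply Cmod_gt_0.
  transitivity (al ^ 2 * mu' / (kap * Cmod z) ^ 3); [field; lra|]. rewrite Hal. field. lra. }
assert (H2 : forall x : R, cflip b x = x) by apply cflip_RtoC.
assert (H12 : cflip b (1 / 2) = (1/2)%C) by (rewrite <- RtoC_div by lra; apply H2).
assert (H32 : cflip b (3 / 2) = (3/2)%C) by (rewrite <- RtoC_div by lra; apply H2).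
rewrite v2scal_C, Ed. set (K' := RtoC (mu' / _)) in *. set (K := RtoC (mu / _)) in *.
assert (HK : cflip b K = K) by apply H2.
destruct k; unfold normal_rhs, twist; fold K K'.
- C_eq; ring.
- rewrite !cflip_mult, cflip_plus, !cflip_mult, HK, H12, H32, cflip_conj.
  rewrite <- Ek, Cmult_conj.
  transitivity (RtoC (al ^ 2) * K' * (1 / 2 * (g * cflip b (X B2)) + 3 / 2 * cflip b (dirsq z) * (g * (g * Cconj g)) * Cconj (cflip b (X B2))))%C; [C_eq; ring|].
  rewrite Hgg. C_eq; ring.
- rewrite !cflip_mult, cflip_minus, !cflip_mult, HK, H12, H32, cflip_conj.
  rewrite <- Ek, !Cmult_conj.
  transitivity (RtoC (al ^ 2) * K' * (1 / 2 * (g * rho * cflip b (X B3)) - 3 / 2 * cflip b (dirsq z) * (g * (g * Cconj g)) * (Cconj rho * u') * Cconj (cflip b (X B3))))%C; [C_eq; ring|].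
  rewrite Hgg, Hr. C_eq; ring.
Qed.

Lemma real_linear_zero (F : config -> C) : real_linear F -> F (fun _ => (0, 0)) = (0, 0).
Proof.
intros [H _]. specialize (H (-1) (fun _ => (0, 0)) (fun _ => (0, 0))). cbv beta in H.
assert (E : v2add (v2scal (-1) (0, 0)) (0, 0) = (0, 0)) by (apply injective_projections; simpl; ring).
rewrite E in H. rewrite H. apply injective_projections; simpl; ring.
Qed.

Lemma real_linear_scal (F : config -> C) (s : R) (X : config) :
  real_linear F -> F (fun j => v2scal s (X j)) = v2scal s (F X).
Proof.
intros HF. assert (E := proj1 HF s X (fun _ => (0, 0))). rewrite real_linear_zero in E by auto.
replace (fun j : body => v2scal s (X j)) with (fun j : body => v2add (v2scal s (X j)) (0, 0)).
- rewrite E. apply injective_projections; simpl; ring.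
- apply functional_extensionality. intros j. apply injective_projections; simpl; ring.
Qed.

(** The image solution is G(xi(t)) with s = al (t - t0) + t1. Each derivative in s produces a factor
    1/al, and the intertwining hypothesis carries the matching al^2. *)
Lemma solves_linearized_transfer (m m' : body -> R) c c' (q q' : R -> config) (G : config -> config)
  (al t0 t1 : R) (xi v : R -> config) :
  al <> 0 -> (forall i, 0 < m i) -> (forall i, 0 < m' i) ->
  (forall k, real_linear (fun X => G X k)) ->
  (forall t X i, v2scal (al ^ 2) (lin_accel m' c' (q' (al * (t - t0) + t1)) (G X) i)
                 = G (lin_accel m c (q t) X) i) ->
  solves_linearized m c q xi v ->
  solves_linearized m' c' q' (fun s => G (xi (/ al * (s - t1) + t0)))
    (fun s i => v2scal (/ al) (G (v (/ al * (s - t1) + t0)) i)).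
Proof.
intros Hal Hm Hm' HG HI [acc [Dxi [Dv Hacc]]].
assert (Sc : forall x y : R -> C, vderiv x y ->
   vderiv (fun s => x (/ al * (s - t1) + t0)) (fun s => v2scal (/ al) (y (/ al * (s - t1) + t0)))).
{ intros x y D. eapply vderiv_ext; [reflexivity| |apply vderiv_affine, D].
  intros t. now rewrite v2scal_C. }
exists (fun s i => v2scal (/ al) (v2scal (/ al) (G (acc (/ al * (s - t1) + t0)) i))).
split; [|split].
- intros i. apply (Sc (fun t => G (xi t) i) (fun t => G (v t) i)). now apply (HG i).
- intros i. assert (D : vderiv (fun t => G (v t) i) (fun t => G (acc t) i)) by now apply (HG i).
  apply Sc in D. apply (vderiv_mult (RtoC (/ al))) in D.
  eapply vderiv_ext; [| |apply D]; intros t; cbv beta; now rewrite !v2scal_C.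
- intros s i. set (t := / al * (s - t1) + t0).
  assert (Es : s = al * (t - t0) + t1) by (unfold t; field; auto).
  assert (Ea : acc t = lin_accel m c (q t) (xi t)).
  { apply functional_extensionality. intros j. unfold lin_accel. rewrite <- Hacc.
    specialize (Hm j). apply injective_projections; simpl; field; lra. }
  rewrite Ea, <- HI, <- Es. unfold lin_accel. specialize (Hm' i).
  apply injective_projections; simpl; field; lra.
Qed.

(** * Homographic solutions as Kepler motions *)

Lemma homographic_C r th (a : config) t : homographic r th a t = (fun i => kz r th t * a i)%C.
Proof.
apply functional_extensionality. intros i. unfold homographic, rotR, kz.
apply injective_projections; simpl; ring.
Qed.

(** Differentiating q_i = a_i z twice gives q_i'' = -mu a_i z/|z|^3. Newton's equation at time 0,
    divided by z/|z|^3, becomes [force c a i] = -mu m_i a_i about the origin, with the same mu as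
    the Kepler orbit; [cc_shape] then applies. *)
Lemma homographic_kepler_data (m : body -> R) c (a : config) r th e :
  (forall i, 0 < m i) -> (forall i j, c i j = c j i) -> non_collinear a ->
  keplerian_orbit r th e -> solves_newton m c (homographic r th a) ->
  exists mu v, 0 < mu /\ kepler_sol mu (kz r th) v /\
    eccentricity mu (kz r th 0) (v 0) = e /\
    (m B1 * a B1 + m B2 * a B2 + m B3 * a B3)%C = 0 /\
    (forall i j, i <> j -> c i j / v2norm (v2sub (a j) (a i)) ^ 3 = mu * m i * m j / total m).
Proof.
intros Hm Hc Hnc [Hr [mu [v [acc [Hmu [Dz [Dv [Ha He]]]]]]]] [vq [aq [D1 [D2 HN]]]].
assert (Hz : forall t, (kz r th t : C) <> 0).
{ intros t E. assert (P := Hr t). assert (Q := sin2_cos2 (th t)). unfold Rsqr in Q.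
  injection E; intros E2 E1.
  apply Rmult_integral in E1. apply Rmult_integral in E2. destruct E1, E2; nra. }
exists mu, v. split; auto. split; [|split; auto].
{ split; [exact Hz|]. split; auto. eapply vderiv_ext; [reflexivity| |apply Dv]. auto. }
apply cc_shape; auto; [lra|].
intros i.
assert (Ev : forall t, vq t i = (a i * v t)%C).
{ apply (vderiv_unique (fun t => a i * kz r th t)%C).
  - eapply vderiv_ext; [| |apply D1]; auto. intros t. cbv beta. rewrite homographic_C. C_eq. ring.
  - now apply vderiv_mult. }
assert (Eq : aq 0 i = (a i * acc 0)%C).
{ refine (vderiv_unique (fun t => a i * v t)%C (fun t => aq t i) (fun t => a i * acc t)%C _ _ 0).
  - refine (vderiv_ext (fun t => vq t i) _ (fun t => aq t i) _ Ev _ (D2 i)). reflexivity.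
  - exact (vderiv_mult (a i) v acc Dv). }
assert (E := HN 0 i). rewrite Eq, Ha, homographic_C, force_scal, !v2scal_C in E by apply Hz.
set (z := kz r th 0) in *. assert (Hz0 : (z : C) <> 0) by apply Hz.
assert (N := v2norm_pos _ Hz0). set (n := v2norm z) in *.
rewrite v2scal_C. C_eq.
assert (Hk : RtoC (/ n ^ 3) <> 0) by (apply RtoC_neq_0; apply Rinv_neq_0_compat, pow_nonzero; lra).
revert E. generalize (force c a i : C). intros F E.
transitivity (z * RtoC (/ n ^ 3) * F / (z * RtoC (/ n ^ 3)))%C; [field; auto|].
change vec with C in E. rewrite <- E. unfold Rdiv. rewrite !RtoC_mult. C_eq; field. auto.
Qed.

Lemma non_collinear_side (a : config) k : non_collinear a -> side a k <> 0.
Proof.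
intros H E. apply H. unfold v2cross, v2sub. destruct k; simpl in E; injection E; intros E2 E1; simpl.
- replace (fst (a B3)) with (fst (a B2)) by lra. replace (snd (a B3)) with (snd (a B2)) by lra. ring.
- replace (fst (a B3)) with (fst (a B1)) by lra. replace (snd (a B3)) with (snd (a B1)) by lra. ring.
- replace (fst (a B2)) with (fst (a B1)) by lra. replace (snd (a B2)) with (snd (a B1)) by lra. ring.
Qed.

(** The position z is recovered as (q_2 - q_1)/(a_2 - a_1), so a configuration and its Kepler orbit
    have the same periods. *)
Lemma homographic_eq_iff r th (a : config) s t : side a B3 <> 0 ->
  ((forall i, homographic r th a s i = homographic r th a t i) <-> kz r th s = kz r th t).
Proof.
intros Hs. rewrite !homographic_C. generalize (kz r th s : C) (kz r th t : C). intros x y.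
split; [|intros ->; auto].
intros H. assert (E1 := H B1). assert (E2 := H B2). simpl in *.
change vec with C in *.
transitivity ((x * a B2 - x * a B1) / (a B2 - a B1))%C; [field; auto|].
rewrite E1, E2. field. auto.
Qed.

Lemma lin_accel_normal_form (m : body -> R) c mu r th (a : config) t X :
  (forall i, 0 < m i) -> (kz r th t : C) <> 0 -> non_collinear a ->
  (m B1 * a B1 + m B2 * a B2 + m B3 * a B3)%C = 0 ->
  (forall i j, i <> j -> c i j / v2norm (v2sub (a j) (a i)) ^ 3 = mu * m i * m j / total m) ->
  lin_accel m c (homographic r th a t) (assemble m a X)
  = assemble m a (normal_rhs (mu / v2norm (kz r th t) ^ 3) (dirsq (kz r th t)) (shear m a) X).
Proof.
intros Hm Hz Hnc Hcm Hc. apply functional_extensionality. intros i. rewrite homographic_C.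
apply lin_accel_assemble; auto. intros k. now apply non_collinear_side.
Qed.

(** The map is constant in time, which settles continuity and periodicity; velocities carry 1/al
    because time is rescaled by al. *)
Lemma real_linear_admissible (G G' : config -> config) (al T : R) :
  al <> 0 -> (forall k, real_linear (fun X => G X k)) ->
  (forall X i, G (G' X) i = X i) -> (forall X i, G' (G X) i = X i) ->
  admissible_transform
    (fun (_ : R) (x : state) i => (G (fun j => fst (x j)) i, v2scal (/ al) (G (fun j => snd (x j)) i))) T.
Proof.
intros Hal HG GG' G'G.
assert (Sinj : forall x y : vec, v2scal (/ al) x = v2scal (/ al) y -> x = y).
{ intros x y E. assert (I := Rinv_neq_0_compat _ Hal). injection E. intros E2 E1.
  apply injective_projections; eapply Rmult_eq_reg_l; eauto. }
split; [|split; [|split; [|split]]].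
- intros _ s x y i. unfold st_lin. simpl. f_equal.
  + apply (HG i).
  + rewrite (proj1 (HG i)). apply injective_projections; simpl; ring.
- intros _ x y E i.
  assert (E1 : G (fun j => fst (x j)) = G (fun j => fst (y j))).
  { apply functional_extensionality. intros k. specialize (E k). apply (f_equal fst) in E. exact E. }
  assert (E2 : G (fun j => snd (x j)) = G (fun j => snd (y j))).
  { apply functional_extensionality. intros k. specialize (E k). apply (f_equal snd) in E. simpl in E. auto. }
  assert (F1 := G'G (fun j => fst (x j)) i). assert (F2 := G'G (fun j => snd (x j)) i).
  rewrite E1, G'G in F1. rewrite E2, G'G in F2.
  apply injective_projections; [symmetry; exact F1 | symmetry; exact F2].
- intros _ y.
  exists (fun i => (G' (fun j => fst (y j)) i, G' (fun j => v2scal al (snd (y j))) i)).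
  intros i. simpl.
  change (fun j => G' (fun j0 => fst (y j0)) j) with (G' (fun j0 => fst (y j0))).
  change (fun j => G' (fun j0 => v2scal al (snd (y j0))) j) with (G' (fun j0 => v2scal al (snd (y j0)))).
  rewrite !GG'. apply injective_projections; simpl; auto.
  apply injective_projections; simpl; field; auto.
- intros x i t. repeat split; apply continuous_const.
- auto.
Qed.

Theorem theorem1p1
  (m ch : body -> R) (a : config) (r th : R -> R) (e : R)
  (Hm : forall i, 0 < m i)
  (Hdelta : forall i j, i <> j -> 0 < 1 - (ch i / m i) * (ch j / m j))
  (He : 0 <= e < 1)
  (Ha_cc : central_configuration m (charged_coef m ch) a)
  (Ha_nc : non_collinear a)
  (Hkep : keplerian_orbit r th e)
  (Hsol : solves_newton m (charged_coef m ch) (homographic r th a)) :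
  0 <= beta m a <= 9 /\
  forall (m' : body -> R) (b : config) (r' th' : R -> R) (T T' : R),
    (forall i, 0 < m' i) ->
    equilateral b ->
    keplerian_orbit r' th' e ->
    solves_newton m' (classical_coef m') (homographic r' th' b) ->
    beta m' b = beta m a ->
    min_period (homographic r th a) T ->
    min_period (homographic r' th' b) T' ->
    exists (phi : R -> R) (P : R -> state -> state),
      (forall t, continuous phi t) /\
      (forall t s, t < s -> phi t < phi s) /\
      (forall t, phi (t + T) = phi t + T') /\
      admissible_transform P T /\
      (forall xi v, solves_linearized m (charged_coef m ch) (homographic r th a) xi v ->
         exists eta w,
           solves_linearized m' (classical_coef m') (homographic r' th' b) eta w /\
           forall t i, P t (mk_state (xi t) (v t)) i = (eta (phi t) i, w (phi t) i)) /\
      (forall eta w, solves_linearized m' (classical_coef m') (homographic r' th' b) eta w ->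
         exists xi v,
           solves_linearized m (charged_coef m ch) (homographic r th a) xi v /\
           forall t i, P t (mk_state (xi t) (v t)) i = (eta (phi t) i, w (phi t) i)).
Proof.
assert (Hs : forall k, side a k <> 0) by (intros; now apply non_collinear_side).
split; [now apply beta_range|].
intros m' b r' th' T T' Hm' [Hb_nc _] Hkep' Hsol' Hbeta [HT [HP HPmin]] [HT' [HP' HPmin']].
assert (Hs' : forall k, side b k <> 0) by (intros; now apply non_collinear_side).
destruct (homographic_kepler_data m (charged_coef m ch) a r th e) as [mu [vz [Hmu [K [Ee [Hcm Hc]]]]]]; auto.
{ intros i j. unfold charged_coef. ring. }
destruct (homographic_kepler_data m' (classical_coef m') b r' th' e) as [mu' [vz' [Hmu' [K' [Ee' [Hcm' Hc']]]]]]; auto.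
{ intros i j. unfold classical_coef. ring. }
assert (Pz : forall t, kz r th (t + T) = kz r th t).
{ intros t. apply (homographic_eq_iff r th a); auto. }
assert (Pz' : forall t, kz r' th' (t + T') = kz r' th' t).
{ intros t. apply (homographic_eq_iff r' th' b); auto. }
destruct (kepler_similar mu mu' e T T' (kz r th) vz (kz r' th') vz')
  as [al [t0 [t1 [kap [fl [g [Hal [Hkap [Hg [Hsc Hz]]]]]]]]]]; auto; [lra|].
assert (Hg0 : g <> 0) by (intros E; rewrite E, Cmod_0 in Hg; lra).
assert (Hinv : forall s, al * (/ al * (s - t1) + t0 - t0) + t1 = s) by (intros; field; lra).
(* Minimality on both sides: otherwise T'/al would be a shorter period of the charged orbit, or al T
   a shorter period of the classical one. *)
assert (HTT : T' = al * T).
{ destruct (Rtotal_order T' (al * T)) as [L|[L|L]]; auto; exfalso.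
  - destruct (HPmin (T' / al)) as [t [i Hne]].
    + split; [now apply Rdiv_lt_0_compat|].
      apply (Rmult_lt_reg_l al); auto. replace (al * (T' / al)) with T' by (field; lra). auto.
    + apply Hne. apply (proj2 (homographic_eq_iff r th a _ t (Hs B3))).
      assert (E := Hz (t + T' / al)).
      replace (al * (t + T' / al - t0) + t1) with ((al * (t - t0) + t1) + T') in E by (field; lra).
      rewrite Pz', Hz in E.
      rewrite <- (cflip_cflip fl (kz r th t)), <- (cflip_cflip fl (kz r th (t + T' / al))). f_equal.
      assert (RtoC kap <> 0) by (apply RtoC_neq_0; lra).
      transitivity (/ (kap * g) * (kap * g * cflip fl (kz r th (t + T' / al))))%C; [field; auto|].
      rewrite <- E. field; auto.
  - destruct (HPmin' (al * T)) as [t [i Hne]].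
    + split; auto. now apply Rmult_lt_0_compat.
    + apply Hne. apply (proj2 (homographic_eq_iff r' th' b _ t (Hs' B3))).
      rewrite <- (Hinv t).
      replace (al * (/ al * (t - t1) + t0 - t0) + t1 + al * T)
        with (al * ((/ al * (t - t1) + t0 + T) - t0) + t1) by ring.
      rewrite !Hz, Pz. auto. }
(* Equal beta means equal modulus of the two shears, so only a phase has to be corrected. *)
destruct (phase_exists (shear m' b) (cflip fl (shear m a))) as [rho [Hr0 Hr]].
{ rewrite Cmod_cflip. rewrite !beta_shear in Hbeta by auto.
  apply Rsqr_inj; try apply Cmod_ge_0. unfold Rsqr. simpl in Hbeta. lra. }
(* Pass to the decoupled coordinates of one system, twist them, and reassemble in the other
   configuration. *)
set (G := fun X => assemble m' b (twist fl g rho (coords m a X))).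
set (G' := fun X => assemble m a (untwist fl g rho (coords m' b X))).
assert (CA : forall X, coords m a (assemble m a X) = X).
{ intros X. apply functional_extensionality. intros k. apply coords_assemble; auto. }
assert (CA' : forall X, coords m' b (assemble m' b X) = X).
{ intros X. apply functional_extensionality. intros k. apply coords_assemble; auto. }
assert (AC : forall X, assemble m a (coords m a X) = X).
{ intros X. apply functional_extensionality. intros k. apply assemble_coords; auto. }
assert (AC' : forall X, assemble m' b (coords m' b X) = X).
{ intros X. apply functional_extensionality. intros k. apply assemble_coords; auto. }
assert (GG' : forall X, G (G' X) = X).
{ intros X. unfold G, G'. rewrite CA.
  replace (twist fl g rho (untwist fl g rho (coords m' b X))) with (coords m' b X); auto.
  apply functional_extensionality. intros k. symmetry. now apply twist_untwist. }
assert (G'G : forall X, G' (G X) = X).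
{ intros X. unfold G, G'. rewrite CA'.
  replace (untwist fl g rho (twist fl g rho (coords m a X))) with (coords m a X); auto.
  apply functional_extensionality. intros k. symmetry. now apply untwist_twist. }
assert (LG : forall k, real_linear (fun X => G X k)).
{ intros k. apply (real_linear_comp (fun X => assemble m' b X k) (fun X => twist fl g rho (coords m a X))).
  - apply real_linear_assemble.
  - intros j. apply (real_linear_comp (fun X => twist fl g rho X j) (coords m a)).
    + apply real_linear_twist.
    + apply real_linear_coords. }
assert (LG' : forall k, real_linear (fun X => G' X k)).
{ intros k. apply (real_linear_comp (fun X => assemble m a X k) (fun X => untwist fl g rho (coords m' b X))).
  - apply real_linear_assemble.
  - intros j. apply (real_linear_comp (fun X => untwist fl g rho X j) (coords m' b)).
    + apply real_linear_untwist.
    + apply real_linear_coords. }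
assert (HI : forall t X i,
  v2scal (al ^ 2) (lin_accel m' (classical_coef m') (homographic r' th' b (al * (t - t0) + t1)) (G X) i)
  = G (lin_accel m (charged_coef m ch) (homographic r th a t) X) i).
{ intros t X i. unfold G at 1.
  rewrite (lin_accel_normal_form m' _ mu'); auto; [|apply K'].
  rewrite <- (AC X) at 2. rewrite (lin_accel_normal_form m _ mu); auto; [|apply K].
  unfold G. rewrite CA.
  rewrite <- (real_linear_scal _ (al ^ 2) _ (real_linear_assemble m' b i)).
  f_equal. apply functional_extensionality. intros k.
  apply (normal_rhs_twist mu mu' al kap); auto. apply K. }
(* The inverse intertwining relation, obtained by conjugating [HI] with [G']. *)
assert (HI' : forall s Y i,
  v2scal ((/ al) ^ 2) (lin_accel m (charged_coef m ch) (homographic r th a (/ al * (s - t1) + t0)) (G' Y) i)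
  = G' (lin_accel m' (classical_coef m') (homographic r' th' b s) Y) i).
{ intros s Y i. set (t := / al * (s - t1) + t0).
  rewrite <- (G'G (lin_accel m (charged_coef m ch) (homographic r th a t) (G' Y))).
  rewrite <- (real_linear_scal _ ((/ al) ^ 2) _ (LG' i)). f_equal.
  apply functional_extensionality. intros k. rewrite <- HI, GG'. unfold t. rewrite Hinv.
  generalize (lin_accel m' (classical_coef m') (homographic r' th' b s) Y k). intros x.
  apply injective_projections; simpl; field; lra. }
exists (fun t => al * (t - t0) + t1),
  (fun (_ : R) (x : state) i => (G (fun j => fst (x j)) i, v2scal (/ al) (G (fun j => snd (x j)) i))).
split; [|split; [|split; [|split; [|split]]]].
- intros t. apply (ex_derive_continuous (fun t => al * (t - t0) + t1)). auto_derive. auto.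
- intros t s L. generalize (Rmult_lt_compat_l al t s Hal L). lra.
- intros t. rewrite HTT. ring.
- apply (real_linear_admissible G G'); auto; [lra| |]; intros X i; [now rewrite GG' | now rewrite G'G].
- intros xi v Sol.
  eexists _, _. split.
  + apply (solves_linearized_transfer m m' (charged_coef m ch) (classical_coef m')
      (homographic r th a) (homographic r' th' b) G al t0 t1 xi v); auto; lra.
  + intros t i. unfold mk_state. simpl.
    replace (/ al * (al * (t - t0) + t1 - t1) + t0) with t by (field; lra). reflexivity.
- intros eta w Sol.
  eexists _, _. split.
  (* The inverse time change has slope 1/al and exchanges t0 with t1. *)
  + apply (solves_linearized_transfer m' m (classical_coef m') (charged_coef m ch)
      (homographic r' th' b) (homographic r th a) G' (/ al) t1 t0 eta w); auto.
    now apply Rinv_neq_0_compat, Rgt_not_eq.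
  + intros t i. unfold mk_state. simpl. rewrite Rinv_inv.
    change (fun j : body => G' (eta (al * (t - t0) + t1)) j) with (G' (eta (al * (t - t0) + t1))).
    rewrite (real_linear_scal (fun X => G X i) al (fun j => G' (w (al * (t - t0) + t1)) j)) by apply LG.
    change (fun j : body => G' (w (al * (t - t0) + t1)) j) with (G' (w (al * (t - t0) + t1))).
    rewrite !GG'. f_equal. apply injective_projections; simpl; field; lra.
Qed.
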